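(* Let $n,m\ge 1$ and let $\mathbf g=[g_1,\dots,g_m]$ with $g_1,\dots,g_m\in\mathbb R[\mathbf x]=\mathbb R[x_1,\dots,x_n]$ be such that $S_{\mathbf g}=\{x\in\mathbb R^n:g_j(x)\ge 0,\ j=1,\dots,m\}$ is nonempty, compact and contained in $[-1,1]^n$. Let $d_{\mathbf g}=\max_j\deg g_j$. Then there is a constant $C_{\mathbf g}>0$ depending only on $\mathbf g$ such that for every $f\in\mathbb R[\mathbf x]$ with $\deg f=d$ and $f>0$ on $S_{\mathbf g}$, one has $$f\in\mathcal R(1\pm\mathbf x,\mathbf g)_{r(n+m)}\quad\text{for}\quad r=C_{\mathbf g}\,60^d\,d^{4\mathbf L_{\mathbf g}+3}\,n^{2d_{\mathbf g}d}\,\kappa_{S_{\mathbf g}}(f)^{2\mathbf L_{\mathbf g}}.$$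
   Context: For an array of polynomials $\mathbf q=[q_1,\dots,q_l]$ and $\alpha\in\mathbb N^l$, $\mathbf q^\alpha=\prod_{j=1}^l q_j^{\alpha_j}$. For real $r\ge 0$ the truncated preprime is the set of finite sums $\mathcal R(\mathbf q)_r=\{\sum_{\alpha\in\mathbb N^l}s_\alpha\mathbf q^\alpha:\ s_\alpha\in\mathbb R_+,\ \deg(s_\alpha\mathbf q^\alpha)\le r,\ \alpha\in\mathbb N^l\}$. The array $(1\pm\mathbf x,\mathbf g)$ is $[1-x_1,1+x_1,\dots,1-x_n,1+x_n,g_1,\dots,g_m]$. For $f>0$ on $S_{\mathbf g}$: $f_{\min}=\min_{x\in S_{\mathbf g}}f(x)$, $\|f\|_{\sup}=\sup_{x\in[-1,1]^n}|f(x)|$, and $\kappa_{S_{\mathbf g}}(f)=\|f\|_{\sup}/f_{\min}$. Łojasiewicz exponent: let $\operatorname{dist}(x,S_{\mathbf g})$ be the Euclidean distance and $G(x)=\max_{j=1,\dots,m}\max\{0,-g_j(x)\}$. $\mathbf L_{\mathbf g}$ is the smallest real $L>0$ for which there is a constant $c\ge 0$ with $\operatorname{dist}(x,S_{\mathbf g})^{L}\le c\,G(x)$ for all $x\in[-1,1]^n$. (In the degenerate case where no smallest such exponent exists, which happens only if $[-1,1]^n\subseteq S_{\mathbf g}$ or $[-1,1]^n\cap S_{\mathbf g}=\emptyset$, set $\mathbf L_{\mathbf g}=1$.) *)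

(* Defs.v *)
(* The notations of mpoly clash with those of MathComp-Analysis, so they are
   left out: [mpoly n R] is the type of polynomials in n variables over R. *)
From mathcomp Require Import all_boot all_order all_algebra.
From mathcomp Require Import -(notations) mpoly.
From mathcomp Require Import all_classical all_reals all_analysis.

Set Implicit Arguments.
Unset Strict Implicit.
Unset Printing Implicit Defensive.

Import Order.TTheory GRing.Theory Num.Theory numFieldNormedType.Exports.
Local Open Scope classical_set_scope.
Local Open Scope ring_scope.

(* The smallest element of A, and x0 when there is none. *)
Definition least {R : realType} (x0 : R) (A : set R) : R :=
  xget x0 (A `&` lbound A).

(* [msize] is one more than the total degree; the zero polynomial is given
   degree 0. *)
Definition pdeg {R : realType} {n : nat} (p : mpoly n R) : nat := (msize p).-1.

Definition peval {R : realType} {n : nat} (p : mpoly n R) (x : 'rV[R]_n) : R :=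
  meval (x ord0) p.

Definition cube (R : realType) (n : nat) : set 'rV[R]_n :=
  [set x | forall i, -1 <= x ord0 i <= 1].

Definition basic_set {R : realType} {n m : nat} (g : m.-tuple (mpoly n R)) :
    set 'rV[R]_n :=
  [set x | forall j, 0 <= peval (tnth g j) x].

Definition max_deg {R : realType} {n m : nat} (g : m.-tuple (mpoly n R)) : nat :=
  (\max_(j < m) pdeg (tnth g j))%N.

Definition array_exp {R : realType} {n : nat} (q : seq (mpoly n R))
    (alpha : multinom (size q)) : mpoly n R :=
  \prod_(j < size q) q`_j ^+ alpha j.

(* The finite set of exponents occurring in the sum is listed by A. *)
Definition preprime {R : realType} {n : nat} (q : seq (mpoly n R)) (r : R) :
    set (mpoly n R) :=
  [set f | exists (A : seq (multinom (size q))) (s : multinom (size q) -> R),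
     [/\ uniq A,
         forall alpha, alpha \in A -> 0 <= s alpha,
         forall alpha, alpha \in A ->
           (pdeg (s alpha *: array_exp alpha))%:R <= r
       & f = \sum_(alpha <- A) s alpha *: array_exp alpha]].

Definition pvar (R : realType) (n : nat) (i : 'I_n) : mpoly n R :=
  mpolyX R (mnm1 i).

(* [1 - x_1, 1 + x_1, ..., 1 - x_n, 1 + x_n] *)
Definition box_array (R : realType) (n : nat) : seq (mpoly n R) :=
  flatten [seq [:: 1 - pvar R i; 1 + pvar R i] | i <- enum 'I_n].

Definition min_on {R : realType} {n : nat} (f : mpoly n R) (S : set 'rV[R]_n) :
    R :=
  least 0 [set peval f x | x in S].

Definition sup_norm {R : realType} {n : nat} (f : mpoly n R) : R :=
  sup [set `|peval f x| | x in @cube R n].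

Definition kappa {R : realType} {n : nat} (S : set 'rV[R]_n) (f : mpoly n R) : R :=
  sup_norm f / min_on f S.

(* The library norm on 'rV[R]_n is the maximum norm, hence the explicit
   Euclidean norm. *)
Definition eucl_norm {R : realType} {n : nat} (x : 'rV[R]_n) : R :=
  Num.sqrt (\sum_(i < n) x ord0 i ^+ 2).

Definition eucl_dist {R : realType} {n : nat} (x : 'rV[R]_n)
    (S : set 'rV[R]_n) : R :=
  inf [set eucl_norm (x - y) | y in S].

Definition violation {R : realType} {n m : nat} (g : m.-tuple (mpoly n R))
    (x : 'rV[R]_n) : R :=
  \big[Num.max/0]_(j < m) Num.max 0 (- peval (tnth g j) x).

(* The default value 1 is the convention for degenerate g. *)
Definition lojasiewicz {R : realType} {n m : nat} (g : m.-tuple (mpoly n R)) :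
    R :=
  least 1 [set L : R | 0 < L /\
    exists2 c : R, 0 <= c &
      forall x, cube x ->
        eucl_dist x (basic_set g) `^ L <= c * violation g x].

(* Main.v *)
Require Import Defs.
From mathcomp Require Import all_boot all_order all_algebra.
From mathcomp Require Import -(notations) mpoly.
From mathcomp Require Import all_classical all_reals all_analysis.
From mathcomp Require Import ring lra zify.
From mathcomp Require Import ordered_qelim.
From mathcomp Require polyrcf qe_rcf.
Import Order.TTheory GRing.Theory Num.Theory numFieldNormedType.Exports.
Local Open Scope classical_set_scope.
Local Open Scope ring_scope.

(** The constraints are traded for new variables. Write [S] for the feasible
    set, [e] for the minimum of [f] on [S], [N] for the supremum norm of [f]
    on the cube and [L] for the Lojasiewicz exponent. For [M] large and
    [A >= 0] consider the polynomial

      [F (u, y) = f (2 u - 1) + A * \sum_j (y_j - g_j (2 u - 1) / M) ^ 2]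

    in [n + m] variables ([lift]). The substitution [u_i = (1 + x_i) / 2],
    [y_j = g_j / M] kills the penalty and gives back [f] ([comp_graph_lift]).
    The substituted polynomials and their complements to 1 lie in the preprime
    in a degree that depends only on [g] ([preprime_graph]). Hence it suffices
    to write [F] as a nonnegative combination of products of powers of [v] and
    [1 - v], where [v] runs through the [n + m] variables. The Bernstein
    expansion of [F] on the unit cube is such a combination once its
    coefficients are nonnegative.

    Positivity of [F]. As [y_j >= 0], the penalty is at least
    [A * (G / M) ^ 2], where [G] is the violation of the constraints, and at
    distance [t] from [S] this is at least [A * t ^ (2 L)] up to a constant.
    There [f >= e - l * t] for a Lipschitz constant [l]. So [A] may be taken
    of order [e * (l / e) ^ (2 L)], and then [F >= e / 2] ([penalty_bound],
    [lift_ge]). Comparing the penalty with the loss [l * t], and not with the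
    norm of [f], is what gives the power [2 L] of the condition number and
    not [2 L + 1].

    Degree. The Bernstein coefficients of degree [r] differ from values of [F]
    by at most [W * D ^ 2 / r], where [D] bounds the degree of [F] and [W] the
    sum of the absolute values of its coefficients ([bernstein_nonneg]); so
    [r] of order [W * D ^ 2 / e] suffices. Both [l] and [W] are bounded by
    [N] through the Chebyshev expansion, whose coefficients are at most
    [2 ^ n * N] by discrete orthogonality ([cheb_expansion]): [l] is [N] times
    a polynomial in [d] ([poly_lipschitz]), and the coefficients of
    [f (2 u - 1)] contribute [N * 7 ^ d] times a polynomial in [d]
    ([coef_bounded_comp]). The exponents of [d] depend only on [g], so the gap
    between [7 ^ d] and [60 ^ d] absorbs them ([degree_estimate]).

    The exponent [L]. The inequality must hold for [L] itself, so the infimum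
    of the exponents has to be attained. Let [h t] be the largest distance to
    [S] of a point of the cube whose violation is at most [t] ([max_dist]).
    By quantifier elimination [h] satisfies [P (t, h t) = 0] for some nonzero
    polynomial [P] ([definable_boundary]). Two monomials of [P] have to be of
    comparable size there, so [h t] is within a constant factor of [t ^ q] for
    some [q] in a finite set ([root_asymptotics]). The inverse of the smallest
    [q] that occurs for arbitrarily small [t] is the least exponent
    ([least_exponent]). When the cube is contained in [S], every positive
    number is an exponent and the conventional value 1 is one of them; in all
    other cases an exponent is at least 1 ([exponent_ge1]). *)

Set Implicit Arguments.
Unset Strict Implicit.
Unset Printing Implicit Defensive.

(** * Chebyshev polynomials *)

Section Chebyshev.
Variable R : realType.

(** Consecutive values are computed together, so that the recurrence needs only
    a plain iteration. The argument lives in any ring because the polynomials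
    are evaluated both at numbers and at the variables. *)
Definition cheb_pair (A : comNzRingType) (x : A) (k : nat) : A * A :=
  iter k (fun p => (p.2, 2 * x * p.2 - p.1)) (1, x).
Definition cheb (A : comNzRingType) (x : A) (k : nat) : A := (cheb_pair x k).1.

Lemma cheb_pairE (A : comNzRingType) (x : A) k :
  cheb_pair x k = (cheb x k, cheb x k.+1).
Proof. by rewrite /cheb /cheb_pair iterS /=; case: (iter _ _ _). Qed.

Lemma chebSS (A : comNzRingType) (x : A) k :
  cheb x k.+2 = 2 * x * cheb x k.+1 - cheb x k.
Proof.
by rewrite {1}/cheb /cheb_pair !iterS -/(cheb_pair x k) cheb_pairE.
Qed.

Lemma rmorph_cheb (A B : comNzRingType) (f : {rmorphism A -> B}) (x : A) k :
  f (cheb x k) = cheb (f x) k.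
Proof.
suff : f (cheb x k) = cheb (f x) k /\ f (cheb x k.+1) = cheb (f x) k.+1 by case.
elim: k => [|k [IH1 IH2]]; first by rewrite /cheb /= rmorph1.
by rewrite chebSS !rmorphE !rmorphM rmorph_nat IH1 IH2 chebSS.
Qed.

Lemma cheb_cos (a : R) k : cheb (cos a) k = cos (k%:R * a).
Proof.
suff : cheb (cos a) k = cos (k%:R * a) /\ cheb (cos a) k.+1 = cos (k.+1%:R * a).
  by case.
elim: k => [|k [IH1 IH2]]; first by rewrite /cheb /= mul0r cos0 mul1r.
split=> //; rewrite chebSS IH1 IH2.
have -> : k.+2%:R * a = k.+1%:R * a + a by rewrite -addn1 natrD mulrDl mul1r.
have -> : k%:R * a = k.+1%:R * a - a by rewrite -addn1 natrD mulrDl mul1r addrK.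
by rewrite cosB cosD; ring.
Qed.

Lemma cosP (x : R) : -1 <= x <= 1 -> exists a, x = cos a.
Proof. by move=> h; exists (acos x); rewrite acosK // in_itv. Qed.

Lemma cheb_le1 (x : R) k : -1 <= x <= 1 -> `|cheb x k| <= 1.
Proof. by move=> /cosP[a ->]; rewrite cheb_cos cos_max. Qed.

Lemma norm_sin_natmul (a : R) k : `|sin (k%:R * a)| <= k%:R * `|sin a|.
Proof.
elim: k => [|k IH]; first by rewrite !mul0r sin0 normr0.
rewrite -addn1 natrD !mulrDl !mul1r sinD.
apply: le_trans (ler_normD _ _) _; rewrite !normrM.
apply: lerD.
  by apply: le_trans IH; rewrite ler_piMr // cos_max.
by rewrite ler_piMl // cos_max.
Qed.

Lemma cosB_sin (a b : R) :
  cos a - cos b = - 2 * sin ((a + b) / 2) * sin ((a - b) / 2).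
Proof.
have ea : a = (a + b) / 2 + (a - b) / 2 by field.
have eb : b = (a + b) / 2 - (a - b) / 2 by field.
move: ea eb; set s := (a + b) / 2; set t := (a - b) / 2 => -> ->.
by rewrite cosB cosD; ring.
Qed.

(** A difference of cosines is a product of two sines, and the sine of [k] times
    an angle is at most [k] times the sine of that angle. This gives Markov's
    constant [k ^ 2] without any derivative. *)
Lemma cheb_lipschitz (x y : R) k : -1 <= x <= 1 -> -1 <= y <= 1 ->
  `|cheb x k - cheb y k| <= k%:R ^+ 2 * `|x - y|.
Proof.
move=> /cosP[a ->] /cosP[b ->]; rewrite !cheb_cos !cosB_sin.
rewrite -mulrDr -mulrBr -!(mulrA k%:R) -!(mulrA (- 2)) !(normrM (- 2)).
rewrite [leRHS]mulrA [leRHS]mulrCA; apply: ler_wpM2l => //.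
rewrite !normrM mulrACA.
by apply: ler_pM => //; exact: norm_sin_natmul.
Qed.

Lemma sin_natmul_pi k : sin (k%:R * pi) = 0 :> R.
Proof.
elim: k => [|k IH]; first by rewrite mul0r sin0.
by rewrite -addn1 natrD mulrDl mul1r sinD IH sinpi mul0r mulr0 addr0.
Qed.

(** Multiplied by [2 * sin (k * h)], where [h] is half the step between nodes,
    the sum telescopes to the sine of a multiple of pi. *)
Lemma sum_cos_nodes (N k : nat) : (0 < k < 2 * N)%N ->
  \sum_(j < N) cos (k%:R * ((2 * j + 1)%:R * (pi / (2 * N)%:R))) = 0 :> R.
Proof.
move=> /andP[k0 kN].
have N0 : (2 * N)%:R != 0 :> R by rewrite pnatr_eq0 -lt0n (leq_trans _ kN).
pose h : R := pi / (2 * N)%:R.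
have hpi : 0 < sin (k%:R * h).
  apply: sin_gt0_pi; rewrite /h mulrA divr_gt0 ?mulr_gt0 ?pi_gt0 ?ltr0n //=; last first.
    by rewrite -(ltr0n R) lt_def N0 ler0n.
  rewrite ltr_pdivrMr ?ltr0n ?(leq_trans _ kN) //.
  by rewrite mulrC ltr_pM2l ?pi_gt0 // ltr_nat.
apply: (mulfI (lt0r_neq0 hpi)); rewrite mulr0.
apply: (mulfI (x := 2)); first by rewrite pnatr_eq0.
rewrite mulr0 mulrA mulr_sumr.
transitivity (\sum_(0 <= j < N) (sin ((2 * j.+1 * k)%:R * h) - sin ((2 * j * k)%:R * h))).
  rewrite big_mkord; apply: eq_bigr => j _; rewrite -/h.
  have -> : (2 * j.+1 * k)%:R * h = k%:R * ((2 * j + 1)%:R * h) + k%:R * h.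
    by rewrite mulrA -natrM -mulrDl -natrD; congr (_%:R * _); lia.
  have -> : (2 * j * k)%:R * h = k%:R * ((2 * j + 1)%:R * h) - k%:R * h.
    apply/eqP; rewrite eq_sym subr_eq mulrA -natrM -mulrDl -natrD.
    by apply/eqP; congr (_%:R * _); lia.
  by rewrite sinD sinB; ring.
rewrite telescope_sumr // muln0 mul0n mul0r sin0 subr0.
have -> : (2 * N * k)%:R * h = k%:R * pi.
  by rewrite /h natrM [_ * k%:R]mulrC -mulrA [X in k%:R * X]mulrC divfK.
exact: sin_natmul_pi.
Qed.

(** The zeros of the Chebyshev polynomial of degree [d + 1]. *)
Definition node (d : nat) (j : 'I_d.+1) : R :=
  cos ((2 * j + 1)%:R * (pi / (2 * d.+1)%:R)).

(** The squared norm of the Chebyshev polynomial of degree [k] for the counting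
    measure on the nodes. *)
Definition node_weight (d : nat) (k : nat) : R :=
  if k == 0%N then d.+1%:R else d.+1%:R / 2.

Lemma node_weight_ge (d k : nat) : d.+1%:R <= 2 * node_weight d k.
Proof.
rewrite /node_weight; have : 0 <= d.+1%:R :> R by rewrite ler0n.
move: d.+1%:R => x x0; case: eqP => _; first by rewrite mulr_natl mulr2n lerDl.
by rewrite mulrC divfK // pnatr_eq0.
Qed.

Lemma cheb_orthogonal (d : nat) (k l : 'I_d.+1) :
  \sum_(j < d.+1) cheb (node j) k * cheb (node j) l =
  (k == l)%:R * node_weight d k.
Proof.
wlog lk : k l / (l <= k)%N.
  move=> H; have [|/ltnW] := leqP l k; first exact: H.
  move=> /(H l k) e; transitivity ((l == k)%:R * node_weight d l).
    by rewrite -e; apply: eq_bigr => j _; rewrite mulrC.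
  by rewrite eq_sym; case: eqP => [->|] //; rewrite !mul0r.
pose c (i : nat) : R :=
  \sum_(j < d.+1) cos (i%:R * ((2 * j + 1)%:R * (pi / (2 * d.+1)%:R))).
have c0 i : (0 < i < 2 * d.+1)%N -> c i = 0 by exact: sum_cos_nodes.
have -> : \sum_(j < d.+1) cheb (node j) k * cheb (node j) l =
    (c (k + l)%N + c (k - l)%N) / 2.
  rewrite /c -big_split /= mulr_suml; apply: eq_bigr => j _.
  rewrite /node !cheb_cos; set a := (2 * j + 1)%:R * _.
  have -> : (k + l)%:R * a = k%:R * a + l%:R * a by rewrite natrD mulrDl.
  have -> : (k - l)%:R * a = k%:R * a - l%:R * a by rewrite natrB // mulrBl.
  by rewrite cosB cosD; field.
have c00 : c 0%N = d.+1%:R.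
  rewrite /c (eq_bigr (fun=> 1)) => [|j _]; last by rewrite mul0r cos0.
  by rewrite sumr_const card_ord.
have kd := ltn_ord k; have ld := ltn_ord l.
rewrite /node_weight; case: eqVneq => [->|nkl].
  rewrite subnn c00 mul1r; case: eqP => [->|/eqP l0].
    by rewrite c00; field.
  rewrite c0 ?add0r //; lia.
rewrite mul0r !c0 ?addr0 ?mul0r //; move: nkl; rewrite -val_eqE /=; lia.
Qed.

End Chebyshev.

(** * Chebyshev expansion of a polynomial of bounded total degree *)

Section ChebyshevExpansion.
Variables (R : realType) (n : nat).
Implicit Types (f p : mpoly n R) (x y : 'rV[R]_n).

Definition chebm (b : 'I_n -> nat) : mpoly n R :=
  \prod_i cheb (pvar R i) (b i).

Lemma peval_chebm b x : peval (chebm b) x = \prod_i cheb (x ord0 i) (b i).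
Proof.
rewrite /peval rmorph_prod; apply: eq_bigr => i _.
by rewrite rmorph_cheb /pvar /= mevalXU.
Qed.

(** The factors are exchanged one at a time, the others being at most one. *)
Lemma prod_diff_le (K : nat) (a b : 'I_K -> R) :
  (forall i, `|a i| <= 1) -> (forall i, `|b i| <= 1) ->
  `|\prod_i a i - \prod_i b i| <= \sum_i `|a i - b i|.
Proof.
elim: K a b => [|K IH] a b ha hb; first by rewrite !big_ord0 subrr normr0.
rewrite !big_ord_recl; set p := \prod_(i < K) _; set q := \prod_(i < K) _.
have -> : a ord0 * p - b ord0 * q = (a ord0 - b ord0) * p + b ord0 * (p - q).
  by ring.
apply: le_trans (ler_normD _ _) _; rewrite !normrM; apply: lerD.
  rewrite ler_piMr // normr_prod.
  by apply: prodr_ile1 => i _; rewrite normr_ge0 ha.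
apply: le_trans (IH _ _ _ _) => //.
by rewrite ler_piMl.
Qed.

Variable d : nat.
Local Notation multidegree := {ffun 'I_n -> 'I_d.+1}.
Definition mdegree (b : multidegree) : nat := (\sum_i b i)%N.

(** The total degree is tracked, and not the degree in each variable, because
    the product of the weights of [n] Chebyshev polynomials is exponential in
    the sum of their degrees. *)
Definition cheb_span (k : nat) f := exists2 t : multidegree -> R,
  f = \sum_b t b *: chebm (fun i => b i) &
  forall b, (k < mdegree b)%N -> t b = 0.

Lemma cheb_span0 k : cheb_span k 0.
Proof.
by exists (fun=> 0) => //; rewrite big1 // => b _; rewrite scale0r.
Qed.

Lemma cheb_spanD k f p : cheb_span k f -> cheb_span k p -> cheb_span k (f + p).
Proof.
move=> [t -> ht] [u -> hu]; exists (fun b => t b + u b).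
  by rewrite -big_split; apply: eq_bigr => b _; rewrite scalerDl.
by move=> b hb; rewrite ht // hu // addr0.
Qed.

Lemma cheb_spanZ k c f : cheb_span k f -> cheb_span k (c *: f).
Proof.
move=> [t -> ht]; exists (fun b => c * t b).
  by rewrite scaler_sumr; apply: eq_bigr => b _; rewrite scalerA.
by move=> b hb; rewrite ht // mulr0.
Qed.

Lemma cheb_span_sum k (I : Type) (r : seq I) (P : pred I) F :
  (forall i, P i -> cheb_span k (F i)) -> cheb_span k (\sum_(i <- r | P i) F i).
Proof.
move=> h; apply: (big_ind (cheb_span k)) => //; first exact: cheb_span0.
exact: cheb_spanD.
Qed.

Lemma cheb_span_le k l f : (k <= l)%N -> cheb_span k f -> cheb_span l f.
Proof.
by move=> kl [t -> ht]; exists t => // b hb; apply: ht; apply: leq_ltn_trans hb.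
Qed.

Lemma cheb_span_chebm k (b : 'I_n -> nat) : (\sum_i b i <= k)%N -> (k <= d)%N ->
  cheb_span k (chebm b).
Proof.
move=> bk kd.
have bd i : (b i < d.+1)%N.
  by rewrite ltnS (leq_trans _ kd) // (leq_trans _ bk) // (bigD1 i) //= leq_addr.
pose b' : multidegree := [ffun i => Ordinal (bd i)].
exists (fun c => (c == b')%:R).
  rewrite (bigD1 b') //= eqxx scale1r big1 ?addr0 => [|c /negbTE->]; last first.
    by rewrite scale0r.
  by apply: eq_bigr => i _; rewrite ffunE.
move=> c; case: eqP => // -> {c}; rewrite ltnNge => /negP[].
by rewrite /mdegree (eq_bigr b) // => i _; rewrite ffunE.
Qed.

(** The recurrence [x * T_v.+1 = (T_v.+2 + T_v) / 2] raises the total degree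
    by one. *)
Lemma cheb_spanX k f i : (k < d)%N -> cheb_span k f ->
  cheb_span k.+1 (pvar R i * f).
Proof.
move=> kd [t -> ht]; rewrite mulr_sumr; apply: cheb_span_sum => b _.
have [bk|/ht->] := leqP (mdegree b) k; last by rewrite scale0r mulr0; exact: cheb_span0.
rewrite -scalerAr; apply: cheb_spanZ.
pose upd (v : nat) (j : 'I_n) : nat := if j == i then v else b j.
have updE v : chebm (upd v) =
    cheb (pvar R i) v * \prod_(j | j != i) cheb (pvar R j) (b j).
  rewrite /chebm (bigD1 i) //= /upd eqxx; congr (_ * _).
  by apply: eq_bigr => j /negbTE->.
have upd_sum v : (\sum_j upd v j = v + \sum_(j | j != i) b j)%N.
  rewrite (bigD1 i) //= /upd eqxx; congr (_ + _)%N.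
  by apply: eq_bigr => j /negbTE->.
have bE : chebm (fun j => b j) = chebm (upd (b i)).
  by apply: eq_bigr => j _; rewrite /upd; case: eqP => [->|].
have bS : (mdegree b = b i + \sum_(j | j != i) b j)%N.
  by rewrite /mdegree (bigD1 i).
have h1 : cheb_span k.+1 (chebm (upd (b i).+1)).
  by apply: cheb_span_chebm => //; rewrite upd_sum addSn -bS ltnS.
rewrite bE updE mulrA; case: (nat_of_ord (b i)) bS h1 => [|v] bS h1.
  by move: h1; rewrite updE mulr1.
have h2 : cheb_span k.+1 (chebm (upd v)).
  apply: cheb_span_chebm => //; rewrite upd_sum; lia.
have -> : pvar R i * cheb (pvar R i) v.+1 =
    2^-1 *: (cheb (pvar R i) v.+2 + cheb (pvar R i) v).
  rewrite chebSS subrK -mulrA mulr_natl.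
  rewrite -[X in _ *: X](scaler_nat 2 (_ : mpoly n R) : (2 : R) *: _ = _).
  by rewrite scalerA mulVf ?scale1r // pnatr_eq0.
rewrite -scalerAl mulrDl -!updE.
by apply: cheb_spanZ; apply: cheb_spanD.
Qed.

Lemma cheb_span_full f : (pdeg f <= d)%N -> cheb_span d f.
Proof.
move=> fd; rewrite (mpolyE f) big_seq; apply: cheb_span_sum => m /msize_mdeg_lt hm.
apply: cheb_spanZ.
have {hm}: (mdeg m <= d)%N by move: fd hm; rewrite /pdeg; lia.
suff h k : mdeg m = k -> (k <= d)%N -> cheb_span k (mpolyX R m).
  by move=> md; exact: (cheb_span_le md (h _ erefl md)).
elim: k m {f fd} => [|k IH] m.
  move=> /eqP; rewrite mdeg_eq0 => /eqP-> _; rewrite mpolyX0.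
  have <- : chebm (fun=> 0%N) = 1 by rewrite /chebm big1.
  by apply: cheb_span_chebm; rewrite // big1.
move=> e kd; have /existsP[i hi] : [exists i : 'I_n, m i != 0%N].
  apply: contraTT isT => /existsPn h.
  have : mdeg m = 0%N by rewrite mdegE big1 // => i _; apply/eqP/negPn/h.
  by rewrite e.
have hm : m = mnm_add (mnm1 i) (mnm_sub m (mnm1 i)).
  by rewrite addmC submK //; rewrite lep1mP.
rewrite hm mpolyXD; apply: cheb_spanX; first exact: kd.
by apply: IH; [move: e; rewrite {1}hm mdegD mdeg1; lia | exact: ltnW].
Qed.

Definition grid_point (J : {ffun 'I_n -> 'I_d.+1}) : 'rV[R]_n :=
  \row_i node R (J i).

Lemma grid_point_cube J : cube (grid_point J).
Proof.
by move=> i; rewrite mxE -ler_norml; exact: cos_max.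
Qed.

Lemma chebm_orthogonal (b c : multidegree) :
  \sum_J peval (chebm (fun i => b i)) (grid_point J) *
         peval (chebm (fun i => c i)) (grid_point J) =
  (b == c)%:R * \prod_i node_weight R d (b i).
Proof.
transitivity (\prod_i ((b i == c i)%:R * node_weight R d (b i)) : R).
  under [RHS]eq_bigr do rewrite -cheb_orthogonal.
  rewrite bigA_distr_bigA; apply: eq_bigr => J _.
  by rewrite !peval_chebm -big_split; apply: eq_bigr => i _; rewrite !mxE.
rewrite big_split /=; congr (_ * _); case: eqVneq => [->|bc].
  by rewrite big1 // => i _; rewrite eqxx.
have /existsP[i hi] : [exists i, b i != c i].
  apply: contraR bc => /existsPn h; apply/eqP/ffunP => i.
  by apply/eqP/negPn/h.
by apply/eqP/prodf_eq0; exists i; rewrite // (negbTE hi).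
Qed.

(** The coefficients are recovered from the values at the nodes by discrete
    orthogonality. Each weight is at least half the number of nodes, whence
    the factor 2 for each variable. *)
Lemma cheb_expansion f (M : R) : (pdeg f <= d)%N ->
  (forall x, cube x -> `|peval f x| <= M) ->
  exists t : multidegree -> R,
    [/\ f = \sum_b t b *: chebm (fun i => b i),
        forall b, (d < mdegree b)%N -> t b = 0 &
        forall b, `|t b| <= 2 ^+ n * M].
Proof.
move=> fd hM; have [t ft ht] := cheb_span_full fd.
exists t; split=> // b.
have w0 k : 0 < node_weight R d k by rewrite /node_weight; case: eqP; rewrite ?divr_gt0.
pose W := \prod_i node_weight R d (b i).
have W0 : 0 < W by apply: prodr_gt0.
have e : \sum_J peval f (grid_point J) * peval (chebm (fun i => b i)) (grid_point J)
    = t b * W.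
  transitivity (\sum_(c : multidegree) t c * ((c == b)%:R * W)).
    transitivity (\sum_c t c * \sum_J peval (chebm (fun i => c i)) (grid_point J) *
         peval (chebm (fun i => b i)) (grid_point J)); last first.
      apply: eq_bigr => c _; congr (_ * _); rewrite chebm_orthogonal.
      by case: eqP => [->|]; rewrite ?mul0r.
    under [RHS]eq_bigr do rewrite mulr_sumr.
    rewrite exchange_big; apply: eq_bigr => J _ /=.
    rewrite ft {1}/peval raddf_sum /= mulr_suml; apply: eq_bigr => c _.
    by rewrite mevalZ mulrA.
  rewrite (bigD1 b) //= eqxx mul1r big1 ?addr0 // => c /negbTE->.
  by rewrite mul0r mulr0.
rewrite -(ler_pM2r W0) -[X in _ * X <= _](gtr0_norm W0) -normrM -e.
apply: le_trans (ler_norm_sum _ _ _) _.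
have cn J : `|peval f (grid_point J) * peval (chebm (fun i => b i)) (grid_point J)| <= M.
  rewrite normrM -[leRHS]mulr1; apply: ler_pM => //; first exact/hM/grid_point_cube.
  rewrite peval_chebm normr_prod; apply: prodr_ile1 => i _.
  by rewrite normr_ge0 cheb_le1 //; exact: grid_point_cube.
have M0 : 0 <= M by exact: le_trans (normr_ge0 _) (cn [ffun=> ord0]).
apply: (@le_trans _ _ (\sum_(J : multidegree) M)); first exact: ler_sum.
rewrite sumr_const card_ffun !card_ord -[leLHS]mulr_natl mulrAC ler_wpM2r //.
rewrite natrX -(card_ord n) -!prodr_const -big_split /=.
by apply: ler_prod => i _; rewrite ler0n node_weight_ge.
Qed.

End ChebyshevExpansion.

(** * Lipschitz and coefficient bounds in terms of the supremum norm *)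

Section CoefficientBounds.
Variable R : realType.

Lemma coord_le_eucl_norm n (x : 'rV[R]_n) i : `|x ord0 i| <= eucl_norm x.
Proof.
rewrite /eucl_norm -sqrtr_sqr ler_wsqrtr // (bigD1 i) //= lerDl.
by apply: sumr_ge0 => j _; exact: sqr_ge0.
Qed.

Lemma eucl_norm_ge0 n (x : 'rV[R]_n) : 0 <= eucl_norm x.
Proof. exact: sqrtr_ge0. Qed.

Definition markov_const (n d : nat) : R :=
  d.+1%:R ^+ n * 2 ^+ n * (d%:R ^+ 2 * n%:R).

(** A weak form of Markov's inequality: the sum of the Lipschitz constants of
    the terms of the Chebyshev expansion. Only its polynomial growth in [d]
    matters, because the power of [d] that results is absorbed by an
    exponential. *)
Lemma poly_lipschitz n (f : mpoly n R) d M : (pdeg f <= d)%N ->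
  (forall x, cube x -> `|peval f x| <= M) ->
  forall x y, cube x -> cube y ->
  `|peval f x - peval f y| <= markov_const n d * M * eucl_norm (x - y).
Proof.
move=> fd hM x y cx cy.
have [t [ft ht tM]] := cheb_expansion fd hM.
have M0 : 0 <= M by exact: le_trans (normr_ge0 _) (hM _ cx).
have E z : peval f z = \sum_b t b * \prod_i cheb (z ord0 i) (b i).
  rewrite ft {1}/peval raddf_sum; apply: eq_bigr => b _ /=.
  by rewrite mevalZ -peval_chebm.
rewrite !E -sumrB; apply: le_trans (ler_norm_sum _ _ _) _.
have bound (b : {ffun 'I_n -> 'I_d.+1}) :
    `|t b * \prod_i cheb (x ord0 i) (b i) - t b * \prod_i cheb (y ord0 i) (b i)|
    <= 2 ^+ n * M * (d%:R ^+ 2 * n%:R * eucl_norm (x - y)).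
  rewrite -mulrBr normrM; apply: ler_pM => //.
  apply: le_trans (prod_diff_le _ _) _ => [i|i|].
  - exact: cheb_le1.
  - exact: cheb_le1.
  have -> : d%:R ^+ 2 * n%:R * eucl_norm (x - y) =
      \sum_(i < n) d%:R ^+ 2 * eucl_norm (x - y).
    by rewrite sumr_const card_ord -[RHS]mulr_natr mulrAC.
  apply: ler_sum => i _; apply: le_trans (cheb_lipschitz _ (cx i) (cy i)) _.
  apply: ler_pM; rewrite ?sqr_ge0 ?normr_ge0 //.
    by rewrite lerXn2r ?nnegrE ?ler0n // ler_nat -ltnS.
  by have := coord_le_eucl_norm (x - y) i; rewrite !mxE.
apply: le_trans (ler_sum _ (fun b _ => bound b)) _.
rewrite sumr_const card_ffun !card_ord -[leLHS]mulr_natl natrX /markov_const.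
rewrite le_eqVlt; apply/orP; left; apply/eqP; ring.
Qed.

(** The list need not be reduced, which makes sums and products a matter of
    concatenating and pairing lists. *)
Definition coef_bounded k (D : nat) (w : R) (p : mpoly k R) :=
  exists s : seq (R * multinom k),
    [/\ p = \sum_(c <- s) c.1 *: mpolyX R c.2,
        forall c, c \in s -> (mdeg c.2 <= D)%N &
        \sum_(c <- s) `|c.1| <= w].

Section Closure.
Variable k : nat.
Implicit Types (p q : mpoly k R) (D E : nat) (v w : R).

Lemma coef_bounded_le D E v w p : (D <= E)%N -> v <= w ->
  coef_bounded D v p -> coef_bounded E w p.
Proof.
move=> DE vw [s [-> sD sv]]; exists s; split=> //; last exact: le_trans vw.
by move=> c /sD h; exact: leq_trans DE.
Qed.

Lemma coef_boundedX D (m : multinom k) : (mdeg m <= D)%N ->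
  coef_bounded D 1 (mpolyX R m).
Proof.
move=> hm; exists [:: (1, m)]; split.
- by rewrite big_seq1 scale1r.
- by move=> c; rewrite inE => /eqP->.
- by rewrite big_seq1 normr1.
Qed.

Lemma coef_bounded0 D : coef_bounded D 0 (0 : mpoly k R).
Proof. by exists [::]; rewrite !big_nil. Qed.

Lemma coef_boundedZ D w c p : coef_bounded D w p ->
  coef_bounded D (`|c| * w) (c *: p).
Proof.
move=> [s [-> sD sv]]; exists [seq (c * a.1, a.2) | a <- s]; split.
- by rewrite big_map scaler_sumr; apply: eq_bigr => a _; rewrite scalerA.
- by move=> b /mapP[a /sD h ->].
- rewrite big_map; under eq_bigr do rewrite normrM.
  by rewrite -mulr_sumr ler_wpM2l.
Qed.

Lemma coef_boundedC D c : coef_bounded D `|c| (mpolyC k c).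
Proof.
have h0 : (mdeg (@mnm0 k) <= D)%N by rewrite mdeg0.
have := coef_boundedZ c (coef_boundedX h0).
by rewrite mulr1 mpolyX0 -mul_mpolyC mulr1.
Qed.

Lemma coef_boundedD D v w p q : coef_bounded D v p -> coef_bounded D w q ->
  coef_bounded D (v + w) (p + q).
Proof.
move=> [s [-> sD sv]] [r [-> rD rw]]; exists (s ++ r); split.
- by rewrite big_cat.
- by move=> c; rewrite mem_cat => /orP[/sD|/rD].
- by rewrite big_cat lerD.
Qed.

Lemma coef_boundedB D v w p q : coef_bounded D v p -> coef_bounded D w q ->
  coef_bounded D (v + w) (p - q).
Proof.
move=> hp hq; apply: coef_boundedD => //.
by have := coef_boundedZ (-1) hq; rewrite normrN1 mul1r scaleN1r.
Qed.

Lemma coef_boundedM D E v w p q : coef_bounded D v p -> coef_bounded E w q ->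
  coef_bounded (D + E) (v * w) (p * q).
Proof.
move=> [s [-> sD sv]] [r [-> rD rw]].
exists [seq (a.1 * b.1, mnm_add a.2 b.2) | a <- s, b <- r]; split.
- rewrite big_allpairs_dep mulr_suml; apply: eq_bigr => a _; rewrite mulr_sumr.
  apply: eq_bigr => b _ /=.
  by rewrite mpolyXD -scalerAl -scalerAr scalerA.
- move=> c /allpairsP[[a b] /= [/sD ha /rD hb ->]] /=.
  by rewrite mdegD leq_add.
- rewrite big_allpairs_dep.
  rewrite (_ : \sum_(a <- s) _ = (\sum_(a <- s) `|a.1|) * (\sum_(b <- r) `|b.1|)).
    by apply: ler_pM => //; apply: sumr_ge0.
  rewrite mulr_suml; apply: eq_bigr => a _; rewrite mulr_sumr.
  by apply: eq_bigr => b _; rewrite normrM.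
Qed.

Lemma coef_bounded_sum D (I : finType) (F : I -> mpoly k R) (w : I -> R) :
  (forall i, coef_bounded D (w i) (F i)) ->
  coef_bounded D (\sum_i w i) (\sum_i F i).
Proof.
move=> h; apply: (big_rec2 (fun v p => coef_bounded D v p)).
  exact: coef_bounded0.
by move=> i v p _ hp; exact: coef_boundedD.
Qed.

Lemma coef_bounded_prod (I : finType) (F : I -> mpoly k R) (D : I -> nat)
    (w : I -> R) :
  (forall i, coef_bounded (D i) (w i) (F i)) ->
  coef_bounded (\sum_i D i) (\prod_i w i) (\prod_i F i).
Proof.
move=> h; apply: (big_rec3 (fun D v p => coef_bounded D v p)).
  by rewrite -(normr1 R) -mpolyC1; exact: coef_boundedC.
by move=> i E v p _ hp; exact: coef_boundedM.
Qed.

(** The recurrence multiplies the weight by at most [2 * 3] and adds the weight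
    before, and [6 * 7 + 1 <= 7 ^ 2]. *)
Lemma coef_bounded_cheb p j : coef_bounded 1 3 p ->
  coef_bounded j (7 ^+ j) (cheb p j).
Proof.
move=> hp; suff : coef_bounded j (7 ^+ j) (cheb p j) /\
    coef_bounded j.+1 (7 ^+ j.+1) (cheb p j.+1) by case.
elim: j => [|j [IH1 IH2]].
  split; first by rewrite expr0 -(normr1 R) /cheb /= -mpolyC1; exact: coef_boundedC.
  by apply: coef_bounded_le hp; rewrite // expr1 ler_nat.
split=> //; rewrite chebSS -mulrA mulr_natl.
have := coef_boundedZ 2 (coef_boundedM hp IH2); rewrite scaler_nat => h.
have {}IH1 := coef_bounded_le (leq_trans (leqnSn _) (leqnSn _)) (lexx _) IH1.
have := coef_boundedB h IH1; apply: coef_bounded_le => //.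
rewrite normr_nat !exprS; have : 0 <= 7 ^+ j :> R by rewrite exprn_ge0.
by move: (7 ^+ j) => x x0; lra.
Qed.

Lemma coef_boundedP p : exists w, coef_bounded (pdeg p) w p.
Proof.
exists (\sum_(c <- [seq (mcoeff m p, m) | m <- msupp p]) `|c.1|).
exists [seq (mcoeff m p, m) | m <- msupp p]; split=> //.
  by rewrite big_map; exact: mpolyE.
by move=> c /mapP[m /msize_mdeg_lt h ->] /=; rewrite /pdeg; lia.
Qed.

Lemma coef_bounded_ge0 D w p : coef_bounded D w p -> 0 <= w.
Proof. by move=> [s [_ _]]; apply: le_trans; exact: sumr_ge0. Qed.

Lemma coef_bounded_eval D w p x : coef_bounded D w p -> cube x ->
  `|peval p x| <= w.
Proof.
move=> [s [-> _ sw]] cx; rewrite /peval raddf_sum /=.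
apply: le_trans (ler_norm_sum _ _ _) (le_trans _ sw); apply: ler_sum => c _.
rewrite mevalZ mevalX normrM ler_piMr // normr_prod.
apply: prodr_ile1 => i _; rewrite normr_ge0 normrX exprn_ile1 //.
by rewrite ler_norml cx.
Qed.

End Closure.

Lemma comp_pvar n k (lq : n.-tuple (mpoly k R)) i :
  comp_mpoly lq (pvar R i) = tnth lq i.
Proof. by rewrite comp_mpolyXU (tnth_nth 0). Qed.

(** The number of terms of the Chebyshev expansion is polynomial in [d], and a
    term of total degree at most [d] has weight at most [7 ^ d]. *)
Lemma coef_bounded_comp n k (f : mpoly n R) d M (lq : n.-tuple (mpoly k R)) :
  (pdeg f <= d)%N -> (forall x, cube x -> `|peval f x| <= M) ->
  (forall i, coef_bounded 1 3 (tnth lq i)) ->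
  coef_bounded d (d.+1%:R ^+ n * (2 ^+ n * M * 7 ^+ d)) (comp_mpoly lq f).
Proof.
move=> fd hM hq; have [t [ft ht tM]] := cheb_expansion fd hM.
rewrite [f in comp_mpoly _ f]ft raddf_sum /=.
have -> : d.+1%:R ^+ n * (2 ^+ n * M * 7 ^+ d) =
    \sum_(b : {ffun 'I_n -> 'I_d.+1}) (2 ^+ n * M * 7 ^+ d).
  by rewrite sumr_const card_ffun !card_ord -[RHS]mulr_natl natrX.
apply: coef_bounded_sum => b; rewrite comp_mpolyZ.
have M0 : 0 <= 2 ^+ n * M by exact: le_trans (tM b).
have [hb|/ht->] := leqP (mdegree b) d; last first.
  rewrite scale0r; apply: (@coef_bounded_le k d d 0 _ 0 (leqnn d) _ (coef_bounded0 k d)).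
  by rewrite mulr_ge0 // exprn_ge0.
apply: (@coef_bounded_le k (mdegree b) d (`|t b| * 7 ^+ mdegree b)) => //.
  apply: ler_pM; rewrite ?exprn_ge0 ?normr_ge0 ?tM //.
  by rewrite ler_weXn2l // ler1n.
apply: coef_boundedZ; rewrite rmorph_prod /= expr_sum.
apply: coef_bounded_prod => i; rewrite rmorph_cheb.
by apply: coef_bounded_cheb; rewrite /= comp_pvar.
Qed.

End CoefficientBounds.

(** * Bernstein expansion on the unit cube *)

Section Bernstein.
Variable R : realType.

Definition bern (A : comNzRingType) (r i : nat) (v : A) : A :=
  v ^+ i * (1 - v) ^+ (r - i) *+ 'C(r, i).

Lemma rmorph_bern (A B : comNzRingType) (f : {rmorphism A -> B}) r i (v : A) :
  f (bern r i v) = bern r i (f v).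
Proof. by rewrite /bern rmorphMn rmorphM !rmorphXn rmorphB rmorph1. Qed.

Lemma bin_trinomial r i k : (k <= i <= r)%N ->
  ('C(r, i) * 'C(i, k) = 'C(r, k) * 'C(r - k, i - k))%N.
Proof.
move=> /andP[ki ir]; have kr := leq_trans ki ir.
have p : (0 < k`! * (i - k)`! * (r - i)`!)%N by rewrite !muln_gt0 !fact_gt0.
apply/eqP; rewrite -(eqn_pmul2r p); apply/eqP.
have e1 := bin_fact ir; have e2 := bin_fact ki; have e3 := bin_fact kr.
have e4 := bin_fact (leq_sub2r k ir).
have e5 : (r - k - (i - k) = r - i)%N by lia.
rewrite e5 in e4.
transitivity (r`!)%N; first by rewrite -e1 -e2; ring.
by rewrite -e3 -e4; ring.
Qed.

(** Bernstein polynomials reproduce monomials: factor out [v ^+ k] and recognize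
    the expansion of [(v + (1 - v)) ^+ (r - k)]. *)
Lemma sum_bern (A : comNzRingType) r k (v : A) : (k <= r)%N ->
  \sum_(i < r.+1) bern r i v *+ 'C(i, k) = v ^+ k *+ 'C(r, k).
Proof.
move=> kr; rewrite -(big_mkord xpredT (fun i => bern r i v *+ 'C(i, k))).
rewrite (big_cat_nat (n := k)) //=; last exact: leq_trans kr _.
rewrite big_nat big1 ?add0r => [|i /andP[_ ik]]; last by rewrite bin_small.
rewrite -{1}(add0n k) big_addn subSn // big_mkord.
transitivity (v ^+ k * (v + (1 - v)) ^+ (r - k) *+ 'C(r, k)); last first.
  by rewrite addrC subrK expr1n mulr1.
rewrite addrC exprDn mulr_sumr -sumrMnl; apply: eq_bigr => i _.
have ir : (i <= r - k)%N by rewrite -ltnS.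
have e : ('C(r, i + k) * 'C(i + k, k) = 'C(r - k, i) * 'C(r, k))%N.
  rewrite bin_trinomial; last by lia.
  by rewrite mulnC addnK.
rewrite /bern -mulrnA e mulrnA mulrnAr; congr (_ *+ _ *+ _).
rewrite exprD -subnDA addnC.
by ring.
Qed.

(** The Bernstein coefficient of index [i] of the monomial [v ^+ k]. *)
Definition bern_ratio (r i k : nat) : R := 'C(i, k)%:R / 'C(r, k)%:R.

Lemma bern_ratioE r i k : bern_ratio r i k =
  \prod_(s < k) ((i - s)%:R / (r - s)%:R).
Proof.
have k0 : k`!%:R != 0 :> R by rewrite pnatr_eq0 -lt0n fact_gt0.
rewrite prodf_div -!natr_prod -!ffact_prod -!bin_ffact !natrM /bern_ratio.
by rewrite -mulf_div divff // mulr1.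
Qed.

(** The ratio is a product of [k] fractions [(i - s) / (r - s)] with [s < k], each
    within [s / r] of [i / r]. Truncated subtraction makes this true also when
    [i <= s]. *)
Lemma bern_ratio_approx r i k : (0 < r)%N -> (i <= r)%N -> (k <= r)%N ->
  `|bern_ratio r i k - (i%:R / r%:R) ^+ k| <= k%:R ^+ 2 / r%:R.
Proof.
move=> r0 ir kr; rewrite bern_ratioE -[in X in _ ^+ X](card_ord k) -prodr_const.
have rR : 0 < r%:R :> R by rewrite ltr0n.
have in01 (a b : nat) : (a <= b)%N -> `|a%:R / b%:R| <= 1 :> R.
  move=> ab; rewrite ger0_norm ?divr_ge0 //.
  have [->|b0] := posnP b; first by rewrite invr0 mulr0.
  by rewrite ler_pdivrMr ?ltr0n // mul1r ler_nat.
apply: le_trans (prod_diff_le _ _) _ => [s|s|].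
- by apply: in01; apply: leq_sub2r.
- exact: in01.
have -> : k%:R ^+ 2 / r%:R = \sum_(s < k) (k%:R / r%:R) :> R.
  by rewrite sumr_const card_ord -[RHS]mulr_natl mulrA.
apply: ler_sum => s _; have sk := ltn_ord s.
have rs : 0 < (r - s)%:R :> R by rewrite ltr0n subn_gt0 (leq_trans sk).
have [si|si] := leqP i s.
  rewrite (eqP (si : (i - s)%N == 0%N)) mul0r sub0r normrN ger0_norm ?divr_ge0 //.
  by rewrite ler_pM2r ?invr_gt0 // ler_nat; lia.
have -> : (i - s)%:R / (r - s)%:R - i%:R / r%:R =
   - (s%:R / r%:R * ((r - i)%:R / (r - s)%:R)) :> R.
  rewrite !natrB //; [|lia|exact: ltnW].
  rewrite natrB in rs; last lia.
  by field; rewrite !gt_eqF.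
rewrite normrN normrM ger0_norm ?divr_ge0 //.
apply: (@le_trans _ _ (s%:R / r%:R)).
  by rewrite ler_piMr ?divr_ge0 // in01 //; lia.
by rewrite ler_pM2r ?invr_gt0 // ler_nat ltnW.
Qed.

(** Up to [w * D ^ 2 / r], the Bernstein coefficient of index [I] is the value
    of [F] at the grid point [I / r], which is at least [e]. *)
Lemma bernstein_nonneg K (F : mpoly K R) D w e r :
  coef_bounded D w F -> (0 < r)%N -> (D <= r)%N ->
  (forall x : 'rV[R]_K, (forall l, 0 <= x ord0 l <= 1) -> e <= peval F x) ->
  w * D%:R ^+ 2 <= e * r%:R ->
  exists2 b : {ffun 'I_K -> 'I_r.+1} -> R, (forall I, 0 <= b I) &
    F = \sum_I b I *: \prod_l bern r (I l) (pvar R l).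
Proof.
move=> [s [Fs sD sw]] r0 Dr Fe wD.
have rR : 0 < r%:R :> R by rewrite ltr0n.
have le_D c l : c \in s -> (c.2 l <= D)%N.
  by move=> /sD; apply: leq_trans; rewrite mdegE (bigD1 l) //= leq_addr.
exists (fun I : {ffun 'I_K -> 'I_r.+1} => \sum_(c <- s) c.1 * \prod_l bern_ratio r (I l) (c.2 l)).
  move=> I; pose x : 'rV[R]_K := \row_l ((I l)%:R / r%:R).
  have Ir l : (I l <= r)%N by rewrite -ltnS.
  have hx l : 0 <= x ord0 l <= 1.
    by rewrite mxE divr_ge0 //= ler_pdivrMr // mul1r ler_nat.
  have := Fe _ hx; rewrite Fs /peval raddf_sum /= => h.
  have {h} : e <= \sum_(c <- s) c.1 * \prod_l (x ord0 l) ^+ (c.2 l).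
    by apply: le_trans h _; rewrite le_eqVlt; apply/orP; left; apply/eqP;
      apply: eq_bigr => c _; rewrite mevalZ mevalX.
  set S1 := \sum_(c <- s) _; set S2 := \sum_(c <- s) _ => h.
  have : `|S2 - S1| <= e.
    rewrite -(ler_pM2r rR); apply: le_trans wD; rewrite -ler_pdivlMr //.
    rewrite /S1 /S2 -sumrB -mulrA; apply: le_trans (ler_norm_sum _ _ _) _.
    have D2 : 0 <= D%:R ^+ 2 / r%:R :> R by rewrite divr_ge0 ?exprn_ge0.
    apply: (@le_trans _ _ (\sum_(c <- s) `|c.1| * (D%:R ^+ 2 / r%:R))); last first.
      by rewrite -mulr_suml ler_wpM2r.
    rewrite [X in X <= _]big_seq [X in _ <= X]big_seq; apply: ler_sum => c cs.
    rewrite -mulrBr normrM ler_wpM2l //.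
    apply: le_trans (prod_diff_le _ _) _ => [l|l|].
    - rewrite /bern_ratio ger0_norm ?divr_ge0 // ler_pdivrMr ?ltr0n ?bin_gt0; last first.
        exact: leq_trans (le_D _ _ cs) Dr.
      by rewrite mul1r ler_nat leq_bin2l.
    - by rewrite normrX exprn_ile1 // ger0_norm; case/andP: (hx l).
    apply: (@le_trans _ _ (\sum_l (c.2 l)%:R ^+ 2 / r%:R)).
      apply: ler_sum => l _; rewrite mxE; apply: bern_ratio_approx => //.
      exact: leq_trans (le_D _ _ cs) Dr.
    rewrite -mulr_suml ler_pM2r ?invr_gt0 //.
    under eq_bigr do rewrite -natrX.
    rewrite -natr_sum -natrX ler_nat.
    apply: (@leq_trans (\sum_l c.2 l * D)%N).
      by apply: leq_sum => l _; rewrite -mulnn leq_mul2l le_D // orbT.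
    by rewrite -big_distrl /= -mdegE -mulnn leq_mul2r sD // orbT.
  by rewrite ler_norml => /andP[+ _]; move: h; clear; move: S1 S2 => S1 S2; lra.
rewrite {1}Fs.
under [RHS]eq_bigr do rewrite scaler_suml.
rewrite exchange_big /= big_seq [RHS]big_seq; apply: eq_bigr => c cs.
under [RHS]eq_bigr do rewrite -scalerA -scaler_prod.
rewrite -scaler_sumr -(bigA_distr_bigA (fun l (i : 'I_r.+1) =>
  bern_ratio r i (c.2 l) *: bern r i (pvar R l))).
congr (_ *: _); rewrite mpolyXE_id; apply: eq_bigr => l _ /=.
have cr : (c.2 l <= r)%N by exact: leq_trans (le_D _ _ cs) Dr.
have b0 : 'C(r, c.2 l)%:R != 0 :> R by rewrite pnatr_eq0 -lt0n bin_gt0.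
apply: (scalerI b0); rewrite scaler_nat -sum_bern // scaler_sumr.
apply: eq_bigr => i _; rewrite scalerA /bern_ratio mulrC divfK // scaler_nat //.
Qed.

End Bernstein.

(** * Calculus of the truncated preprime *)

Section Preprime.
Variables (R : realType) (n : nat).
Implicit Types (p f h : mpoly n R) (q : seq (mpoly n R)) (r : R).

Lemma pdegZ c p : c != 0 -> pdeg (c *: p) = pdeg p.
Proof. by move=> c0; rewrite /pdeg msizeZ. Qed.

Lemma pdegM_le p h : (pdeg (p * h)%R <= pdeg p + pdeg h)%N.
Proof.
rewrite /pdeg; have [->|p0] := eqVneq p 0; first by rewrite mul0r msize0.
have [->|h0] := eqVneq h 0; first by rewrite mulr0 msize0.
rewrite msizeM //; move: (mmeasure _ p) (mmeasure _ h) => a b; lia.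
Qed.

Lemma pdegD_le p h D : (pdeg p <= D)%N -> (pdeg h <= D)%N -> (pdeg (p + h)%R <= D)%N.
Proof.
rewrite /pdeg => hp hh; have := msizeD_le p h; rewrite leq_max.
move: (mmeasure _ (p + h)) (mmeasure _ p) (mmeasure _ h) hp hh => a b c.
by move=> hb hc /orP[]; lia.
Qed.

Lemma pdegN p : pdeg (- p) = pdeg p.
Proof. by rewrite /pdeg msizeN. Qed.

Lemma pdegC (c : R) : pdeg (mpolyC n c) = 0%N.
Proof. by rewrite /pdeg msizeC; case: eqP. Qed.

Lemma pdegX (m : multinom n) : pdeg (mpolyX R m) = mdeg m.
Proof. by rewrite /pdeg msizeX. Qed.

(** Without distinctness of the exponents the sums and products of two
    representations are immediate; repeated exponents are merged by adding
    their coefficients. *)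
Lemma preprimeP q r f : preprime q r f <->
  exists s : seq (R * multinom (size q)),
    [/\ forall c, c \in s -> 0 <= c.1 /\ (pdeg (array_exp c.2))%:R <= r &
        f = \sum_(c <- s) c.1 *: array_exp c.2].
Proof.
split=> [[A [s [uA s0 sr ->]]]|[s [hs ->]]].
  exists [seq (s a, a) | a <- A & s a != 0]; split.
    move=> c /mapP[a]; rewrite mem_filter => /andP[sa aA] -> /=.
    by split; [exact: s0 | have := sr _ aA; rewrite pdegZ].
  rewrite big_map big_filter [RHS]big_mkcond; apply: eq_bigr => a _ /=.
  by case: eqP => //= ->; rewrite scale0r.
exists (undup (map snd s)), (fun a => \sum_(c <- s | c.2 == a) c.1).
have mem_s a : a \in undup (map snd s) -> exists2 c, c \in s & c.2 = a.
  by rewrite mem_undup => /mapP[c cs ->]; exists c.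
split; first exact: undup_uniq.
- move=> a _; rewrite big_seq_cond; apply: sumr_ge0 => c /andP[cs _].
  by have [] := hs _ cs.
- move=> a /mem_s[c cs <-]; have [c0 cr] := hs _ cs.
  have [->|nz] := eqVneq (\sum_(c0 <- s | c0.2 == c.2) c0.1) 0.
    by rewrite scale0r /pdeg msize0 /=; exact: le_trans cr.
  by rewrite pdegZ.
under [RHS]eq_bigr do rewrite scaler_suml.
rewrite (exchange_big_dep xpredT) //= big_seq [RHS]big_seq.
apply: eq_bigr => c cs; rewrite (big_rem c.2) /=; last first.
  by rewrite mem_undup map_f.
rewrite eqxx big_seq_cond big1 ?addr0 // => a /andP[h1 /eqP h2].
by move: h1; rewrite -h2 mem_rem_uniqF // undup_uniq.
Qed.

Lemma preprime_le q r r' f : r <= r' -> preprime q r f -> preprime q r' f.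
Proof.
move=> rr' /preprimeP[s [hs ->]]; apply/preprimeP; exists s; split=> // c /hs[h1 h2].
by split=> //; exact: le_trans rr'.
Qed.

Lemma preprimeD q r f h : preprime q r f -> preprime q r h -> preprime q r (f + h).
Proof.
move=> /preprimeP[s [hs ->]] /preprimeP[t [ht ->]]; apply/preprimeP.
exists (s ++ t); split; last by rewrite big_cat.
by move=> c; rewrite mem_cat => /orP[/hs|/ht].
Qed.

Lemma preprimeM q r r' f h : preprime q r f -> preprime q r' h ->
  preprime q (r + r') (f * h).
Proof.
move=> /preprimeP[s [hs ->]] /preprimeP[t [ht ->]]; apply/preprimeP.
have expD (a b : multinom (size q)) :
    array_exp (mnm_add a b) = array_exp a * array_exp b :> mpoly n R.
  by rewrite /array_exp -big_split; apply: eq_bigr => i _; rewrite mnmDE exprD.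
exists [seq (a.1 * b.1, mnm_add a.2 b.2) | a <- s, b <- t]; split.
  move=> c /allpairsP[[a b] /= [/hs[a0 ar] /ht[b0 br] ->]] /=.
  split; first exact: mulr_ge0.
  rewrite expD; apply: le_trans (lerD ar br); rewrite -natrD ler_nat.
  exact: pdegM_le.
rewrite big_allpairs_dep mulr_suml; apply: eq_bigr => a _; rewrite mulr_sumr.
by apply: eq_bigr => b _; rewrite /= expD -scalerAl -scalerAr scalerA.
Qed.

Lemma preprimeC q r c : 0 <= r -> 0 <= c -> preprime q r (mpolyC n c).
Proof.
move=> r0 c0; apply/preprimeP; exists [:: (c, mnm0)].
have e : array_exp (mnm0 : multinom (size q)) = 1 :> mpoly n R.
  by rewrite /array_exp big1 // => i _; rewrite mnm0E.
split; last by rewrite big_seq1 e /= -mul_mpolyC mulr1.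
by move=> a; rewrite inE => /eqP-> /=; rewrite e -mpolyC1 pdegC.
Qed.

Lemma preprimeZ q r c f : 0 <= c -> preprime q r f -> preprime q r (c *: f).
Proof.
move=> c0 h; rewrite -mul_mpolyC -[r]add0r.
by apply: preprimeM => //; exact: preprimeC.
Qed.

Lemma preprime_mem q f : f \in q -> preprime q (pdeg f)%:R f.
Proof.
move=> fq; have iq : (index f q < size q)%N by rewrite index_mem.
apply/preprimeP; exists [:: (1, mnm1 (Ordinal iq))].
have e : array_exp (mnm1 (Ordinal iq)) = f :> mpoly n R.
  rewrite /array_exp (bigD1 (Ordinal iq)) //= mnm1E eqxx expr1 nth_index //.
  by rewrite big1 ?mulr1 // => j /negbTE h; rewrite mnm1E eq_sym h.
split; last by rewrite big_seq1 e scale1r.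
by move=> c; rewrite inE => /eqP-> /=; rewrite e.
Qed.

Lemma preprime_sum q r (I : Type) (s : seq I) (P : pred I) F : 0 <= r ->
  (forall i, P i -> preprime q r (F i)) ->
  preprime q r (\sum_(i <- s | P i) F i).
Proof.
move=> r0 h; apply: (big_ind (preprime q r)) => //.
  by rewrite -mpolyC0; exact: preprimeC.
exact: preprimeD.
Qed.

Lemma preprime_prod q (I : Type) (s : seq I) (P : pred I) (ri : I -> R) F :
  (forall i, P i -> preprime q (ri i) (F i)) ->
  preprime q (\sum_(i <- s | P i) ri i) (\prod_(i <- s | P i) F i).
Proof.
move=> h; apply: (big_rec2 (fun r f => preprime q r f)).
  by rewrite -mpolyC1; exact: preprimeC.
by move=> i r f Pi hf; apply: preprimeM => //; exact: h.
Qed.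

Lemma preprimeXn q r f k : 0 <= r -> preprime q r f ->
  preprime q (k%:R * r) (f ^+ k).
Proof.
move=> r0 h; elim: k => [|k IH].
  by rewrite mul0r expr0 -mpolyC1; exact: preprimeC.
by rewrite exprS -natr1 mulrDl mul1r addrC; exact: preprimeM.
Qed.

Lemma preprime_bern q r f k i : 0 <= r -> preprime q r f ->
  preprime q r (1 - f) -> (i <= k)%N -> preprime q (k%:R * r) (bern k i f).
Proof.
move=> r0 h h' ik; rewrite /bern.
rewrite (_ : _ *+ _ = ('C(k, i)%:R : R) *: (f ^+ i * (1 - f) ^+ (k - i))); last first.
  by rewrite scaler_nat.
apply: preprimeZ => //.
rewrite -{1}(subnKC ik) natrD mulrDl.
by apply: preprimeM; exact: preprimeXn.
Qed.

Section Box.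
Variable q : seq (mpoly n R).
Hypothesis box_q : {subset box_array R n <= q}.

Lemma mem_box i : (1 - pvar R i \in q) && (1 + pvar R i \in q).
Proof.
have h f : f \in [:: 1 - pvar R i; 1 + pvar R i] -> f \in q.
  move=> hf; apply: box_q; apply/flattenP.
  exists [:: 1 - pvar R i; 1 + pvar R i] => //.
  by apply/mapP; exists i => //; rewrite mem_enum.
by rewrite !h ?inE ?eqxx ?orbT.
Qed.

Lemma preprime_box i : preprime q 1 (1 - pvar R i) /\ preprime q 1 (1 + pvar R i).
Proof.
have /andP[h1 h2] := mem_box i.
have d1 : (pdeg (1%R : mpoly n R) <= 1)%N by rewrite -mpolyC1 pdegC.
have dX : (pdeg (pvar R i) <= 1)%N by rewrite pdegX mdeg1.
split; [have := preprime_mem h1|have := preprime_mem h2]; apply: preprime_le;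
  by rewrite lern1 pdegD_le // pdegN.
Qed.

(** The bounds [-1] and [1] pass to products, as
    [1 + x * y = ((1 + x) * (1 + y) + (1 - x) * (1 - y)) / 2] and
    [1 - x * y = ((1 - x) * (1 + y) + (1 + x) * (1 - y)) / 2]. *)
Lemma preprime_monomial m :
  preprime q (mdeg m)%:R (1 - mpolyX R m) /\
  preprime q (mdeg m)%:R (1 + mpolyX R m).
Proof.
move e : (mdeg m) => k; elim: k m e => [|k IH] m.
  move=> /eqP; rewrite mdeg_eq0 => /eqP->; rewrite mpolyX0 subrr.
  split; first by rewrite -mpolyC0; exact: preprimeC.
  by rewrite -mpolyC1; apply: preprimeD; exact: preprimeC.
move=> e; have /existsP[i hi] : [exists i : 'I_n, m i != 0%N].
  apply: contraTT isT => /existsPn h.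
  have : mdeg m = 0%N by rewrite mdegE big1 // => i _; apply/eqP/negPn/h.
  by rewrite e.
have hm : m = mnm_add (mnm1 i) (mnm_sub m (mnm1 i)).
  by rewrite addmC submK //; rewrite lep1mP.
have [|h1 h2] := IH (mnm_sub m (mnm1 i)).
  by move: e; rewrite {1}hm mdegD mdeg1; lia.
have [b1 b2] := preprime_box i.
rewrite hm mpolyXD -natr1 addrC; set y := mpolyX R (mnm_sub _ _) in h1 h2 *.
set x := mpolyX _ _ in b1 b2 *.
have half p p' : 2 *: p = p' -> p = 2^-1 *: p'.
  by move=> <-; rewrite scalerA mulVf ?scale1r // pnatr_eq0.
split.
  rewrite (_ : 1 - x * y = 2^-1 *: ((1 - x) * (1 + y) + (1 + x) * (1 - y))).
  2: by apply: half; rewrite scaler_nat; ring.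
  by apply: preprimeZ; rewrite ?invr_ge0 //; apply: preprimeD; exact: preprimeM.
rewrite (_ : 1 + x * y = 2^-1 *: ((1 + x) * (1 + y) + (1 - x) * (1 - y))).
  2: by apply: half; rewrite scaler_nat; ring.
by apply: preprimeZ; rewrite ?invr_ge0 //; apply: preprimeD; exact: preprimeM.
Qed.

(** Every term [c * x ^ m] is dominated by [`|c|] because both signs of the
    monomial are. *)
Lemma preprime_coef_bounded D w p : coef_bounded D w p ->
  preprime q D%:R (mpolyC n w - p).
Proof.
move=> [s [-> sD sw]].
have -> : mpolyC n w - \sum_(c <- s) c.1 *: mpolyX R c.2 =
    mpolyC n (w - \sum_(c <- s) `|c.1|) +
    \sum_(c <- s) `|c.1| *: (1 - Num.sg c.1 *: mpolyX R c.2).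
  have -> : \sum_(c <- s) `|c.1| *: (1 - Num.sg c.1 *: mpolyX R c.2) =
      mpolyC n (\sum_(c <- s) `|c.1|) - \sum_(c <- s) c.1 *: mpolyX R c.2.
    rewrite rmorph_sum -sumrB; apply: eq_bigr => c _ /=.
    by rewrite scalerBr scalerA [_ * Num.sg _]mulrC -numEsg -mul_mpolyC mulr1.
  by rewrite mpolyCB; ring.
apply: preprimeD; first by apply: preprimeC => //; rewrite subr_ge0.
rewrite big_seq; apply: preprime_sum => // c cs; apply: preprimeZ => //.
apply: (@preprime_le _ (mdeg c.2)%:R); first by rewrite ler_nat sD.
have [h1 h2] := preprime_monomial c.2.
case: sgrP => _; rewrite ?scale1r ?scale0r ?subr0 ?scaleN1r ?opprK //.
by rewrite -mpolyC1; exact: preprimeC.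
Qed.

End Box.
End Preprime.

(** * Distance to the feasible set and constraint violation *)

Section Distance.
Variables (R : realType) (n : nat).
Implicit Types (x y : 'rV[R]_n) (S : set 'rV[R]_n).

Lemma continuous_sum_seq (T : topologicalType) (I : Type) (r : seq I)
    (F : I -> T -> R) : (forall i, continuous (F i)) ->
  continuous (fun z => \sum_(i <- r) F i z).
Proof.
move=> h; elim: r => [|i r IH].
  by under eq_fun do rewrite big_nil; move=> x; exact: cvg_cst.
by under eq_fun do rewrite big_cons; move=> x; apply: continuousD; [exact: h|exact: IH].
Qed.

Lemma continuous_prod_seq (T : topologicalType) (I : Type) (r : seq I)
    (F : I -> T -> R) : (forall i, continuous (F i)) ->
  continuous (fun z => \prod_(i <- r) F i z).
Proof.
move=> h; elim: r => [|i r IH].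
  by under eq_fun do rewrite big_nil; move=> x; exact: cvg_cst.
by under eq_fun do rewrite big_cons; move=> x; apply: continuousM; [exact: h|exact: IH].
Qed.

Lemma continuous_expr (T : topologicalType) (F : T -> R) k : continuous F ->
  continuous (fun z => F z ^+ k).
Proof.
move=> h z; apply: (@continuous_comp _ _ _ F (fun a : R => a ^+ k)).
  exact: h.
exact: exprn_continuous.
Qed.

Lemma continuous_coord i : continuous (fun x : 'rV[R]_n => x ord0 i).
Proof. by move=> x; exact: coord_continuous. Qed.

Lemma continuous_peval (p : mpoly n R) : continuous (peval p).
Proof.
have -> : peval p = fun x => \sum_(m <- msupp p)
    mcoeff m p * \prod_(i <- index_enum 'I_n) x ord0 i ^+ m i.
  by apply/funext => x; rewrite /peval mevalE.
apply: continuous_sum_seq => m x.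
apply: (@continuousM R _ (fun=> mcoeff m p : R)); first by apply: cst_continuous.
move: x; apply: continuous_prod_seq => i.
by apply: continuous_expr; exact: continuous_coord.
Qed.

Lemma compact_cube : compact (@cube R n).
Proof.
have -> : @cube R n = [set v : 'rV[R]_n | forall i, `[-1, 1]%classic (v ord0 i)].
  by apply/seteqP; split=> x h i; have := h i; rewrite /= in_itv.
by apply: (@rV_compact R n (fun=> `[-1, 1]%classic)) => i; exact: segment_compact.
Qed.

Lemma continuous_eucl_norm y : continuous (fun x => eucl_norm (x - y)).
Proof.
move=> x.
apply: (@continuous_comp _ _ _ (fun x => \sum_(i < n) (x - y) ord0 i ^+ 2) Num.sqrt).
  apply: continuous_sum_seq => i; apply: continuous_expr => {}x.
  under eq_fun do rewrite !mxE.
  by apply: continuousB; [exact: continuous_coord | apply: cst_continuous].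
exact: sqrt_continuous.
Qed.

Section Dist.
Variable S : set 'rV[R]_n.
Hypothesis S0 : S !=set0.

Let img x := [set eucl_norm (x - y) | y in S].

Let img_has_inf x : has_inf (img x).
Proof.
split; first by case: S0 => y Sy; exists (eucl_norm (x - y)), y.
by exists 0 => _ [y _ <-]; exact: eucl_norm_ge0.
Qed.

Lemma eucl_dist_geP x c : c <= eucl_dist x S <->
  forall y, S y -> c <= eucl_norm (x - y).
Proof.
split=> [h y Sy|h].
  apply: le_trans h _; apply: ge_inf; last by exists y.
  by have [] := img_has_inf x.
by apply: lb_le_inf => [|_ [y Sy <-]]; [have [] := img_has_inf x | exact: h].
Qed.

Lemma eucl_dist_le x y : S y -> eucl_dist x S <= eucl_norm (x - y).
Proof. by move=> Sy; move: (lexx (eucl_dist x S)) => /eucl_dist_geP; exact. Qed.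

Lemma eucl_dist_ge0 x : 0 <= eucl_dist x S.
Proof. by apply/eucl_dist_geP => y _; exact: eucl_norm_ge0. Qed.

Lemma eucl_norm0 : eucl_norm (0 : 'rV[R]_n) = 0.
Proof. by rewrite /eucl_norm big1 ?sqrtr0 // => i _; rewrite mxE expr0n. Qed.

Lemma eucl_dist_mem x : S x -> eucl_dist x S = 0.
Proof.
move=> Sx; apply/eqP; rewrite eq_le eucl_dist_ge0 andbT.
by rewrite -eucl_norm0 -[X in eucl_norm X](subrr x) eucl_dist_le.
Qed.

Lemma eucl_dist_cube x : S `<=` @cube R n -> cube x ->
  eucl_dist x S <= Num.sqrt (4 * n%:R).
Proof.
move=> Sc cx; have [y Sy] := S0; apply: le_trans (eucl_dist_le x Sy) _.
rewrite ler_wsqrtr // mulr_natr -[X in _ *+ X](card_ord n) -sumr_const.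
apply: ler_sum => i _; have := cx i; have := Sc _ Sy i; rewrite !mxE.
by move: (x _ _) (y _ _) => a b /andP[h1 h2] /andP[h3 h4]; nra.
Qed.

End Dist.
End Distance.

Section Violation.
Variables (R : realType) (n m : nat) (g : m.-tuple (mpoly n R)).
Let S := basic_set g.
Hypotheses (S0 : S !=set0) (S_cube : S `<=` @cube R n).
Implicit Types (x y : 'rV[R]_n) (t : R).

Lemma violation_leP x t : violation g x <= t <->
  0 <= t /\ forall j, - peval (tnth g j) x <= t.
Proof.
rewrite /violation; split.
  move=> h; split; first by apply: le_trans h; exact: bigmax_ge_id.
  move=> j; apply: le_trans h.
  apply: le_trans (le_bigmax 0 (fun j => Num.max 0 (- peval (tnth g j) x)) j).
  by rewrite le_max lexx orbT.
by move=> [t0 h]; apply: bigmax_le => // j _; rewrite ge_max t0 h.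
Qed.

Lemma violation_ge0 x : 0 <= violation g x.
Proof. exact: bigmax_ge_id. Qed.

Lemma violation_le0 x : violation g x <= 0 -> S x.
Proof. by move=> /violation_leP[_ h] j; have := h j; rewrite oppr_le0. Qed.

(** Every constraint is nonnegative on [S] and Lipschitz on the cube. *)
Lemma violation_lipschitz : exists2 C : R, 0 < C &
  forall x, cube x -> violation g x <= C * eucl_dist x S.
Proof.
have bound j : exists C : R, 0 <= C /\ forall x y, cube x -> cube y ->
    `|peval (tnth g j) x - peval (tnth g j) y| <= C * eucl_norm (x - y).
  have [w hw] := coef_boundedP (tnth g j).
  exists (markov_const R n (pdeg (tnth g j)) * w); split.
    rewrite /markov_const !mulr_ge0 ?exprn_ge0 //; exact: coef_bounded_ge0 hw.
  by apply: poly_lipschitz => // x; exact: coef_bounded_eval hw.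
have [C hC] := choice bound.
have C0 : 0 < 1 + \sum_j C j.
  by rewrite ltr_wpDr // sumr_ge0 // => j _; have [] := hC j.
exists (1 + \sum_j C j) => // x cx.
rewrite mulrC -ler_pdivrMr //; apply/eucl_dist_geP => // y Sy.
rewrite ler_pdivrMr // mulrC; apply/violation_leP; split.
  by rewrite mulr_ge0 ?eucl_norm_ge0 // ltW.
move=> j; have := (hC j).2 _ _ cx (S_cube Sy).
have gy : 0 <= peval (tnth g j) y := Sy j.
rewrite ler_norml => /andP[h _]; apply: (@le_trans _ _ (C j * eucl_norm (x - y))).
  by move: h gy; move: (peval _ x) (peval _ y) (_ * _) => a b c; lra.
rewrite ler_wpM2r ?eucl_norm_ge0 // (bigD1 j) //= addrCA lerDl.
by rewrite addr_ge0 // sumr_ge0 // => i _; have [] := hC i.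
Qed.

Lemma violation_continuous : continuous (violation g).
Proof.
pose G j x : R := Num.max 0 (- peval (tnth g j) x).
have cG j : continuous (G j).
  move=> x; apply: (@continuous_max R _ (fun=> 0) (fun x => - peval (tnth g j) x)).
    by apply: cst_continuous.
  by apply: continuousN; exact: continuous_peval.
have -> : violation g = fun x => \big[Num.max/0]_(j <- index_enum 'I_m) G j x by [].
elim: (index_enum _) => [|j r IH].
  by under eq_fun do rewrite big_nil; move=> x; apply: cst_continuous.
under eq_fun do rewrite big_cons.
move=> x; apply: (@continuous_max R _ (G j) (fun x => \big[Num.max/0]_(j <- r) G j x)).
  exact: cG.
exact: IH.
Qed.

(** The points of the cube at distance at least [e] from [S] form a compact set
    on which the violation attains a positive minimum. *)
Lemma eucl_dist_small e : 0 < e -> exists2 d, 0 < d &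
  forall x, cube x -> violation g x < d -> eucl_dist x S < e.
Proof.
move=> e0; pose K := [set x | cube x /\ forall y, S y -> e <= eucl_norm (x - y)].
have [[x0 Kx0]|hK] := pselect (K !=set0); last first.
  exists 1 => // x cx _; rewrite ltNge; apply/negP => /(eucl_dist_geP S0) h.
  by apply: hK; exists x.
have cK : compact K.
  apply: (subclosed_compact _ (@compact_cube R n)) => [|x []//].
  have -> : K = @cube R n `&` \bigcap_(y in S) [set x | e <= eucl_norm (x - y)].
    by apply/seteqP; split=> x [].
  apply: closedI; first exact: compact_closed (@compact_cube R n).
  apply: closed_bigI => y _.
  by apply: (closed_comp _ (@closed_ge R e)) => x _; exact: continuous_eucl_norm.
have [|c cc hc] := compact_EVT_min (ex_intro _ x0 Kx0) cK (f := violation g).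
  exact/continuous_subspaceT/violation_continuous.
have [_ cS] : K c by rewrite inE in cc.
exists (violation g c).
  rewrite ltNge; apply/negP => /violation_le0 Sc.
  by have := cS _ Sc; rewrite subrr eucl_norm0 leNgt e0.
move=> x cx hx; rewrite ltNge; apply/negP => /(eucl_dist_geP S0) h.
by have := hc x; rewrite inE leNgt hx => /(_ (conj cx h)).
Qed.

End Violation.

(** * Exponents are at least one *)

Section ExponentLowerBound.
Variables (R : realType) (n m : nat) (g : m.-tuple (mpoly n R)).
Let S := basic_set g.
Hypotheses (S0 : S !=set0) (S_cube : S `<=` @cube R n).
Implicit Types (x y : 'rV[R]_n).

Definition lojasiewicz_exponent (L : R) := 0 < L /\
  exists2 c : R, 0 <= c &
    forall x, cube x -> eucl_dist x (basic_set g) `^ L <= c * violation g x.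

Lemma eucl_normZ a x : eucl_norm (a *: x) = `|a| * eucl_norm x.
Proof.
rewrite /eucl_norm -sqrtr_sqr -sqrtrM ?sqr_ge0 // mulr_sumr.
by congr Num.sqrt; apply: eq_bigr => i _; rewrite mxE exprMn.
Qed.

Lemma cube_segment x y (a : R) : cube x -> cube y -> 0 <= a <= 1 ->
  cube (x + a *: (y - x)).
Proof.
move=> cx cy /andP[a0 a1] i; rewrite !mxE; have := cx i; have := cy i.
by move: (x _ _) (y _ _) => u v /andP[? ?] /andP[? ?]; apply/andP; split; nra.
Qed.

(** An exponent below one bounds the distance to [S] from below on the points of
    the cube that are not in [S], because the violation is at most a multiple
    of the distance. Walking in short steps along a segment of the cube that
    ends in [S], the first step into [S] contradicts this. *)
Lemma exponent_ge1 L : ~ (@cube R n `<=` S) -> lojasiewicz_exponent L -> 1 <= L.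
Proof.
move=> /existsNP[x0 /not_implyP[cx0 Sx0]] [L0 [c c0 hL]].
rewrite leNgt; apply/negP => L1.
have [s Ss] := S0; have cs := S_cube Ss.
have [C C0 hC] := violation_lipschitz S0 S_cube.
have dist_gt0 x : cube x -> ~ S x -> 0 < eucl_dist x S.
  move=> cx nSx; rewrite lt_def eucl_dist_ge0 // andbT; apply/eqP => d0.
  by apply: nSx; apply: violation_le0; have := hC _ cx; rewrite -/S d0 mulr0.
pose c' := c * C + 1.
have c'0 : 0 < c' by rewrite ltr_wpDl // mulr_ge0 // ltW.
pose b := ln c' / (1 - L).
(* Solving [d ^ L <= c' * d] for the distance [d] gives its lower bound. *)
have hb x : cube x -> ~ S x -> expR (- b) <= eucl_dist x S.
  move=> cx nSx; have d0 := dist_gt0 _ cx nSx.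
  rewrite -[leRHS]lnK ?posrE // ler_expR.
  have : L * ln (eucl_dist x S) <= ln c' + ln (eucl_dist x S).
    rewrite -ln_powR -lnM ?posrE // ler_ln ?posrE ?powR_gt0 ?mulr_gt0 //.
    apply: le_trans (hL _ cx) _; rewrite -/S.
    apply: (@le_trans _ _ (c * (C * eucl_dist x S))).
      by rewrite ler_wpM2l // hC.
    by rewrite mulrA ler_wpM2r ?eucl_dist_ge0 // /c' lerDl.
  move: (ln (eucl_dist x S)) => d h.
  rewrite lerNl /b ler_pdivlMr ?subr_gt0 //.
  by move: h; clear; move: (ln c') => z; lra.
have [N hN] : exists N : nat, eucl_norm (s - x0) / expR (- b) < N.+1%:R.
  exists (Num.bound (eucl_norm (s - x0) / expR (- b))).
  apply: lt_trans (archi_boundP _) _; last by rewrite ltr_nat.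
  by rewrite divr_ge0 ?eucl_norm_ge0 // expR_ge0.
pose p k := x0 + (k%:R / N.+1%:R) *: (s - x0).
have N0 : N.+1%:R != 0 :> R by rewrite pnatr_eq0.
have pN : p N.+1 = s by rewrite /p divff // scale1r addrC subrK.
have cp k : (k <= N.+1)%N -> cube (p k).
  move=> kN; apply: cube_segment => //.
  by rewrite divr_ge0 //= ler_pdivrMr ?ltr0n // mul1r ler_nat.
suff h k : (k <= N.+1)%N -> ~ S (p k) by apply: (h N.+1); rewrite ?pN.
elim: k => [|k IH] kN; first by rewrite /p mul0r scale0r addr0.
move=> Sp; have := hb _ (cp _ (ltnW kN)) (IH (ltnW kN)).
apply/negP; rewrite -ltNge; apply: le_lt_trans (eucl_dist_le S0 (p k) Sp) _.
have -> : p k - p k.+1 = (- N.+1%:R^-1) *: (s - x0).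
  rewrite /p opprD addrACA subrr add0r -scalerBl -mulrBl; congr (_ *: _).
  by rewrite -natr1 opprD addrA subrr sub0r mulN1r.
rewrite eucl_normZ normrN ger0_norm ?invr_ge0 // mulrC.
by rewrite ltr_pdivrMr ?ltr0n // mulrC -ltr_pdivrMr ?expR_gt0.
Qed.

End ExponentLowerBound.

(** * First-order formulas about points of the space *)

Section Formulas.
Variables (R : realType) (n : nat).
Implicit Types (e : seq R) (f : ord.formula R) (x y : 'rV[R]_n).

Definition row_nth x (k : nat) : R := nth 0 [seq x ord0 i | i <- enum 'I_n] k.

Lemma row_nthE x (i : 'I_n) : row_nth x i = x ord0 i.
Proof.
by rewrite /row_nth (nth_map i) ?size_enum_ord // nth_ord_enum.
Qed.

Definition bind_row e (a : nat) x : seq R :=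
  mkseq (fun k => if (a <= k < a + n)%N then row_nth x (k - a) else e`_k)
    (maxn (size e) (a + n)).

Lemma nth_bind_row e a x k : (bind_row e a x)`_k =
  if (a <= k < a + n)%N then row_nth x (k - a) else e`_k.
Proof.
have [h|h] := ltnP k (maxn (size e) (a + n)); first by rewrite nth_mkseq.
rewrite nth_default ?size_mkseq //; move: h; rewrite geq_max => /andP[h1 h2].
by rewrite nth_default // ltnNge h2 andbF.
Qed.

Lemma nth_bind_row_var e a x (i : 'I_n) : (bind_row e a x)`_(a + i) = x ord0 i.
Proof.
by rewrite nth_bind_row leq_addr ltn_add2l ltn_ord addKn row_nthE.
Qed.

Lemma holds_foldr_exists e f (I : seq nat) :
  ord.holds e (foldr (@ord.Exists R) f I) <->
  exists2 e', (forall k, k \notin I -> e'`_k = e`_k) &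
    ord.holds e' f.
Proof.
elim: I e => [|i I IH] e /=.
  split=> [h|[e' he']]; first by exists e.
  by apply: ord.eq_holds => k; exact: he'.
split=> [[v /IH[e' he' hf]]|[e' he' hf]].
  exists e' => // k; rewrite inE negb_or => /andP[ki kI].
  by rewrite he' // nth_set_nth /= (negbTE ki).
exists e'`_i; apply/IH; exists e' => // k kI.
rewrite nth_set_nth /=; case: eqP => [->//|/eqP ki].
by rewrite he' // inE negb_or ki.
Qed.

Lemma holds_foldr_forall e f (I : seq nat) :
  ord.holds e (foldr (@ord.Forall R) f I) <->
  forall e', (forall k, k \notin I -> e'`_k = e`_k) ->
    ord.holds e' f.
Proof.
elim: I e => [|i I IH] e /=.
  split=> [h e' he'|h]; last exact: h.
  by apply: ord.eq_holds h => k; rewrite he'.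
split=> [h e' he'|h v].
  have /IH := h (e'`_i); apply=> k kI.
  rewrite nth_set_nth /=; case: eqP => [->//|/eqP ki].
  by rewrite he' // inE negb_or ki.
apply/IH => e' he'; apply: h => k; rewrite inE negb_or => /andP[ki kI].
by rewrite he' // nth_set_nth /= (negbTE ki).
Qed.

Lemma same_bind_row e e' a : (forall k, k \notin iota a n -> e'`_k = e`_k) ->
  GRing.same_env e' (bind_row e a (\row_i e'`_(a + i))).
Proof.
move=> he k; rewrite nth_bind_row; case: ifP => [/andP[h1 h2]|h].
  have kn : (k - a < n)%N by rewrite ltn_subLR.
  by rewrite -[(k - a)%N]/(nat_of_ord (Ordinal kn)) row_nthE mxE /= subnKC.
by rewrite he // mem_iota h.
Qed.

Lemma bind_row_outside e a x k : k \notin iota a n -> (bind_row e a x)`_k = e`_k.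
Proof. by rewrite mem_iota nth_bind_row => /negbTE->. Qed.

Lemma holds_exists_row e f a :
  ord.holds e
    (foldr (@ord.Exists R) f (iota a n)) <->
  exists x, ord.holds (bind_row e a x) f.
Proof.
rewrite holds_foldr_exists; split=> [[e' he' hf]|[x hx]].
  exists (\row_i e'`_(a + i)).
  by apply: ord.eq_holds hf; exact: same_bind_row.
by exists (bind_row e a x) => // k; exact: bind_row_outside.
Qed.

Lemma holds_forall_row e f a :
  ord.holds e
    (foldr (@ord.Forall R) f (iota a n)) <->
  forall x, ord.holds (bind_row e a x) f.
Proof.
rewrite holds_foldr_forall; split=> [h x|h e' he'].
  by apply: h => k; exact: bind_row_outside.
apply: ord.eq_holds (h (\row_i e'`_(a + i))) => k.
by apply/esym; exact: same_bind_row.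
Qed.

Definition conj_formula (s : seq (ord.formula R)) :=
  foldr (@ord.And R) (ord.Bool true) s.

Lemma holds_conj_ord k e (F : 'I_k -> ord.formula R) :
  ord.holds e (conj_formula [seq F i | i <- enum 'I_k]) <->
  forall i, ord.holds e (F i).
Proof.
have H (r : seq 'I_k) :
    ord.holds e (conj_formula [seq F i | i <- r]) <->
    forall i, i \in r -> ord.holds e (F i).
  elim: r => [|i r IH] //=; rewrite IH; split=> [[h1 h2] j|h].
    by rewrite inE => /orP[/eqP->|/h2].
  by split=> [|j jr]; apply: h; rewrite inE ?eqxx // jr orbT.
by rewrite H; split=> h i; [apply: h; rewrite mem_enum|].
Qed.

Definition sum_term (s : seq (GRing.term R)) :=
  foldr (@GRing.Add R) (GRing.NatConst R 0) s.
Definition prod_term (s : seq (GRing.term R)) :=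
  foldr (@GRing.Mul R) (GRing.NatConst R 1) s.

Lemma eval_sum_term e s : GRing.eval e (sum_term s) = \sum_(T <- s) GRing.eval e T.
Proof. by elim: s => [|T s IH] /=; rewrite ?big_nil // big_cons IH. Qed.

Lemma eval_prod_term e s :
  GRing.eval e (prod_term s) = \prod_(T <- s) GRing.eval e T.
Proof. by elim: s => [|T s IH] /=; rewrite ?big_nil // big_cons IH. Qed.

(** The variables of the polynomial become those of index [a], [a + 1] and so
    on. *)
Definition mpoly_term (a : nat) (p : mpoly n R) : GRing.term R :=
  sum_term [seq GRing.Mul (GRing.Const (mcoeff m p))
    (prod_term [seq GRing.Exp (GRing.Var R (a + nat_of_ord i)) (fun_of_multinom m i)
               | i <- index_enum 'I_n]) | m <- msupp p].

Lemma eval_mpoly_term e a p x : (forall i : 'I_n, e`_(a + i) = x ord0 i) ->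
  GRing.eval e (mpoly_term a p) = peval p x.
Proof.
move=> hx; rewrite /peval mevalE eval_sum_term big_map; apply: eq_bigr => m _ /=.
by rewrite eval_prod_term big_map; congr (_ * _); apply: eq_bigr => i _ /=; rewrite hx.
Qed.

End Formulas.

(** * Boundary points of definable sets *)

Section DefinableBoundary.
Variable R : realType.
Implicit Types (f : ord.formula R) (T : GRing.term R).
Implicit Types (P Q : mpoly 2 R) (t u : R).

Definition eval2 P t u : R := meval (fun i : 'I_2 => [:: t; u]`_i) P.

Lemma rterm_mpoly T : GRing.rterm T ->
  exists P, forall t u, GRing.eval [:: t; u] T = eval2 P t u.
Proof.
rewrite /eval2.
elim: T => //=.
- move=> i _; case: (ltnP i 2) => hi.
    by exists (mpolyX R (mnm1 (Ordinal hi))) => t u; rewrite mevalXU.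
  by exists 0 => t u; rewrite meval0 nth_default.
- by move=> x _; exists (mpolyC 2 x) => t u; rewrite mevalC.
- by move=> k _; exists (mpolyC 2 k%:R) => t u; rewrite mevalC.
- move=> T1 IH1 T2 IH2 /andP[/IH1[P1 h1] /IH2[P2 h2]].
  by exists (P1 + P2) => t u; rewrite mevalD h1 h2.
- by move=> T1 IH1 /IH1[P1 h1]; exists (- P1) => t u; rewrite mevalN h1.
- by move=> T1 IH1 k /IH1[P1 h1]; exists (P1 *+ k) => t u; rewrite mevalMn h1.
- move=> T1 IH1 T2 IH2 /andP[/IH1[P1 h1] /IH2[P2 h2]].
  by exists (P1 * P2) => t u; rewrite mevalM h1 h2.
move=> T1 IH1 k /IH1[P1 h1]; exists (P1 ^+ k) => t u; rewrite rmorphXn h1 //.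
Qed.

Definition same_signs (s : seq (mpoly 2 R)) t u u' :=
  forall P, P \in s -> Num.sg (eval2 P t u) = Num.sg (eval2 P t u').

Lemma same_signs_cat s1 s2 t u u' : same_signs (s1 ++ s2) t u u' ->
  same_signs s1 t u u' /\ same_signs s2 t u u'.
Proof.
by move=> h; split=> P hP; apply: h; rewrite mem_cat hP ?orbT.
Qed.

Lemma qf_formula_signs f : ord.qf_form f ->
  ord.rformula f ->
  exists s, forall t u u', same_signs s t u u' ->
    ord.qf_eval [:: t; u] f =
    ord.qf_eval [:: t; u'] f.
Proof.
have atom (rel : R -> R -> bool) T1 T2 :
    (forall x y x' y', Num.sg (x - y) = Num.sg (x' - y') -> rel x y = rel x' y') ->
    GRing.rterm T1 && GRing.rterm T2 ->
    exists s, forall t u u', same_signs s t u u' ->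
    rel (GRing.eval [:: t; u] T1) (GRing.eval [:: t; u] T2) =
    rel (GRing.eval [:: t; u'] T1) (GRing.eval [:: t; u'] T2).
  move=> hrel /andP[/rterm_mpoly[P1 h1] /rterm_mpoly[P2 h2]].
  exists [:: P1 - P2] => t u u' hs; apply: hrel.
  have := hs _ (mem_head _ _).
  by rewrite /eval2 !mevalB !h1 !h2.
elim: f => //=.
- by move=> b _ _; exists [::].
- move=> T1 T2 _; apply: (atom (fun x y => x == y)) => x y x' y' h.
  by rewrite -subr_eq0 -[x' == _]subr_eq0 -sgr_eq0 h sgr_eq0.
- move=> T1 T2 _; apply: (atom (fun x y => x < y)) => x y x' y' h.
  by rewrite -subr_lt0 -[x' < _]subr_lt0 -sgr_lt0 h sgr_lt0.
- move=> T1 T2 _; apply: (atom (fun x y => x <= y)) => x y x' y' h.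
  by rewrite -subr_le0 -[x' <= _]subr_le0 -sgr_le0 h sgr_le0.
- move=> f1 IH1 f2 IH2 /andP[q1 q2] /andP[r1 r2].
  have [s1 h1] := IH1 q1 r1; have [s2 h2] := IH2 q2 r2.
  exists (s1 ++ s2) => t u u' /same_signs_cat[/h1-> /h2->] //.
- move=> f1 IH1 f2 IH2 /andP[q1 q2] /andP[r1 r2].
  have [s1 h1] := IH1 q1 r1; have [s2 h2] := IH2 q2 r2.
  exists (s1 ++ s2) => t u u' /same_signs_cat[/h1-> /h2->] //.
- move=> f1 IH1 f2 IH2 /andP[q1 q2] /andP[r1 r2].
  have [s1 h1] := IH1 q1 r1; have [s2 h2] := IH2 q2 r2.
  exists (s1 ++ s2) => t u u' /same_signs_cat[/h1-> /h2->] //.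
move=> f1 IH1 q1 r1; have [s1 h1] := IH1 q1 r1.
by exists s1 => t u u' /h1->.
Qed.

(** A quantifier-free equivalent of [f] depends only on the signs of finitely
    many polynomials. *)
Lemma formula_signs f : exists s, forall t u u', same_signs s t u u' ->
  ord.holds [:: t; u] f -> ord.holds [:: t; u'] f.
Proof.
pose q := ord.quantifier_elim
  (fun (n : nat) (s : seq (GRing.term R) * seq (GRing.term R)) =>
     qe_rcf.qfr_to_formula (qe_rcf.wproj n s)) (ord.to_rform f).
have /andP[qf rf] : ord.qf_form q && ord.rformula q.
  apply: ord.quantifier_elim_wf.
    by move=> i bc /=; exact: qe_rcf.wf_QE_wproj.
  exact: ord.to_rform_rformula.
have [s hs] := qf_formula_signs qf rf.
exists s => t u u' h.
move=> /(qe_rcf.rcf_satP [:: t; u] f) h1.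
apply/(qe_rcf.rcf_satP [:: t; u'] f).
have <- : qe_rcf.rcf_sat [:: t; u] f = qe_rcf.rcf_sat [:: t; u'] f by exact: hs.
exact: h1.
Qed.

Lemma eval2_horner P t :
  exists p : {poly R}, forall u, eval2 P t u = p.[u].
Proof.
exists (mmap polyC (fun i : 'I_2 => [:: t%:P; 'X]`_i) P) => u.
rewrite /eval2 mevalE /mmap horner_sum; apply: eq_bigr => m _.
rewrite hornerM hornerC /mmap1 horner_prod; congr (_ * _); apply: eq_bigr => i _.
rewrite horner_exp; congr (_ ^+ _).
by case: i => -[|[|]] //= _; rewrite ?hornerC ?hornerX.
Qed.

Lemma eval2_sg_locally_constant P t u : eval2 P t u != 0 ->
  exists2 e, 0 < e &
    forall u', `|u' - u| < e -> Num.sg (eval2 P t u') = Num.sg (eval2 P t u).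
Proof.
have [p hp] := eval2_horner P t.
rewrite !hp => h0.
have [|d d0 hd] := polyrcf.poly_cont u p (e := `|p.[u]|).
  by rewrite normr_gt0.
exists d => // u' /hd; rewrite !hp.
have [h1|h1|h1] := ltrgt0P p.[u]; last by rewrite h1 eqxx in h0.
  by rewrite ltr_norml => /andP[h2 _]; rewrite !gtr0_sg //; lra.
by rewrite ltr_norml => /andP[_ h2]; rewrite !ltr0_sg //; lra.
Qed.

(** The product of the nonzero polynomials whose signs decide [f]: where it does
    not vanish, all these signs, hence the truth of [f], are locally constant
    in the second variable. *)
Lemma definable_boundary f : exists2 P, P != 0 & forall t u,
  (forall e, 0 < e -> exists u1 u2, [/\ `|u1 - u| < e, `|u2 - u| < e,
     ord.holds [:: t; u1] f &
     ~ ord.holds [:: t; u2] f]) ->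
  eval2 P t u = 0.
Proof.
have [s hs] := formula_signs f.
exists (\prod_(Q <- s | Q != 0) Q).
  by rewrite prodf_seq_neq0; apply/allP => Q _; exact: implybb.
move=> t u hu; apply: contrapT => /eqP h0.
have [e e0 he] : exists2 e, 0 < e & forall u', `|u' - u| < e -> same_signs s t u' u.
  have {h0} : all (fun Q => (Q == 0) || (eval2 Q t u != 0)) s.
    apply/allP => Q Qs; case: eqVneq => //= Q0; apply: contra h0 => h.
    rewrite /eval2 rmorph_prod /= prodf_seq_eq0; apply/hasP; exists Q => //=.
    by rewrite Q0.
  elim: s {hs} => [|Q s IH] /=; first by exists 1.
  move=> /andP[h1 /IH[e e0 he]].
  have [e' e'0 he'] : exists2 e, 0 < e &
    forall u', `|u' - u| < e -> Num.sg (eval2 Q t u') = Num.sg (eval2 Q t u).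
    case/orP: h1 => [/eqP->|]; last exact: eval2_sg_locally_constant.
    by exists 1 => // u' _; rewrite /eval2 !meval0.
  exists (Num.min e e'); first by rewrite lt_min e0.
  move=> u'; rewrite lt_min => /andP[h2 h3] Q'.
  by rewrite inE => /orP[/eqP->|]; [exact: he' | exact: he].
have [u1 [u2 [h1 h2 h3 h4]]] := hu _ e0.
apply: h4; apply: hs h3 => Q Qs.
by rewrite (he _ h1) // (he _ h2).
Qed.

End DefinableBoundary.

(** * Growth of an algebraic function at zero *)

Section LeastExponent.
Variable R : realType.
Implicit Types (P : mpoly 2 R) (t u q : R).

Lemma seq_argmax (T : eqType) (s : seq T) (v : T -> R) : s != [::] ->
  exists2 x, x \in s & forall y, y \in s -> v y <= v x.
Proof.
elim: s => // x s IH _.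
have [->|/IH[y ys hy]] := eqVneq s [::].
  by exists x; rewrite ?mem_head // => y; rewrite inE => /eqP->.
have [h|h] := lerP (v x) (v y).
  exists y; first by rewrite inE ys orbT.
  by move=> z; rewrite inE => /orP[/eqP->|/hy].
exists x; first exact: mem_head.
move=> z; rewrite inE => /orP[/eqP->//|/hy h1]; exact: le_trans h1 (ltW h).
Qed.

Lemma seq_argmin_prop (s : seq R) (p : R -> Prop) :
  (exists2 x, x \in s & p x) ->
  exists x, [/\ x \in s, p x & forall y, y \in s -> p y -> x <= y].
Proof.
elim: s => [[x]//|a s IH] [x0 x0s px0].
have [/IH[x [xs px hx]]|h] := pselect (exists2 x, x \in s & p x); last first.
  have ax0 : x0 = a.
    by move: x0s; rewrite inE => /orP[/eqP//|h1]; case: h; exists x0.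
  exists a; split; rewrite ?mem_head -?ax0 // => y.
  by rewrite inE ax0 => /orP[/eqP->//|h1 h2]; case: h; exists y.
have [[pa lax]|h] := pselect (p a /\ a <= x).
  exists a; split; rewrite ?mem_head // => y; rewrite inE.
  by move=> /orP[/eqP->//|ys /(hx _ ys)]; exact: le_trans.
exists x; split; rewrite ?inE ?xs ?orbT // => y.
rewrite inE => /orP[/eqP->|]; last exact: hx.
by move=> pa; apply: contrapT => /negP; rewrite -ltNge => /ltW ?; apply: h.
Qed.

(** In a sum that vanishes, the largest term is compensated by the others, so
    one of them has at least its size divided by the number of terms. *)
Lemma comparable_pair (T : eqType) (s : seq T) (v : T -> R) :
  uniq s -> s != [::] -> (forall x, x \in s -> v x != 0) ->
  \sum_(x <- s) v x = 0 ->
  exists x y, [/\ x \in s, y \in s, x != y &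
    `|v y| <= `|v x| <= (size s)%:R * `|v y|].
Proof.
move=> us s0 v0 sum0.
have [x xs hx] := seq_argmax (fun x => `|v x|) s0.
apply: contrapT => hn.
have N0 : 0 < (size s)%:R :> R by rewrite ltr0n; case: s s0 {us v0 sum0 xs hx hn}.
have hlt y : y \in s -> y != x -> `|v y| < `|v x| / (size s)%:R.
  move=> ys yx; rewrite ltr_pdivlMr // mulrC ltNge; apply/negP => h.
  by apply: hn; exists x, y; split; rewrite 1?eq_sym // hx.
have vx : 0 < `|v x| by rewrite normr_gt0 v0.
have : `|v x| <= \sum_(y <- s | y != x) `|v x| / (size s)%:R.
  move: sum0; rewrite (bigD1_seq x) //= => /eqP; rewrite addr_eq0 => /eqP e1.
  rewrite {1}e1 normrN; apply: le_trans (ler_norm_sum _ _ _) _.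
  rewrite [X in X <= _]big_seq_cond [X in _ <= X]big_seq_cond.
  by apply: ler_sum => y /andP[ys yx]; rewrite ltW // hlt.
have : \sum_(y <- s) `|v x| / (size s)%:R = `|v x|.
  rewrite big_const_seq count_predT iter_addr_0 -[LHS]mulr_natr mulfVK //.
  by rewrite gt_eqF.
rewrite (bigD1_seq x) //=.
have := divr_gt0 vx N0; lra.
Qed.

Lemma log_comparison (c c' i i' j j' x y N a : R) : 0 <= N ->
  `|c'| <= a -> `|c| <= a -> c' + i' * x + j' * y <= c + i * x + j * y ->
  c + i * x + j * y <= N + (c' + i' * x + j' * y) ->
  `|(i - i') * x + (j - j') * y| <= N + a + a.
Proof.
rewrite !ler_norml => N0 /andP[a1 a2] /andP[a3 a4] h1 h2.
by apply/andP; split; lra.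
Qed.

Lemma natr_dist_ge1 (i j : nat) : i != j -> 1 <= `|i%:R - j%:R| :> R.
Proof.
rewrite neq_ltn => /orP[] h; [rewrite distrC|]; rewrite -natrB 1?ltnW //;
  by rewrite ger0_norm // ler1n subn_gt0.
Qed.

(** In logarithms [x] and [y], two monomials of comparable size confine [(x, y)]
    to a strip. The strip is not parallel to the [y]-axis when [x] is very
    negative, which gives its slope. *)
Lemma slope_estimate (i j i' j' : nat) (c c' x y N a : R) : 0 <= N ->
  `|c'| <= a -> `|c| <= a ->
  c' + i'%:R * x + j'%:R * y <= c + i%:R * x + j%:R * y ->
  c + i%:R * x + j%:R * y <= N + (c' + i'%:R * x + j'%:R * y) ->
  (i != i') || (j != j') -> x < - (N + a + a) ->
  `|y - (i'%:R - i%:R) / (j%:R - j'%:R) * x| <= N + a + a.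
Proof.
move=> N0 ha' ha h1 h2 ne hx.
have a0 : 0 <= a := le_trans (normr_ge0 _) ha.
have hB := log_comparison N0 ha' ha h1 h2.
have [e|nj] := eqVneq j j'.
  move: ne; rewrite e eqxx orbF => /natr_dist_ge1 h3.
  move: hB; rewrite e subrr mul0r addr0 normrM => hB.
  have : `|x| <= N + a + a by apply: le_trans hB; rewrite ler_peMl.
  by rewrite ler_norml => /andP[h4 _]; move: (lt_le_trans hx h4); rewrite ltxx.
have h3 := natr_dist_ge1 nj.
have h0 : j%:R - j'%:R != 0 :> R by rewrite -normr_gt0 (lt_le_trans _ h3).
have -> : y - (i'%:R - i%:R) / (j%:R - j'%:R) * x =
   ((i%:R - i'%:R) * x + (j%:R - j'%:R) * y) / (j%:R - j'%:R) by field.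
rewrite normrM normfV ler_pdivrMr ?normr_gt0 //.
by apply: le_trans hB _; rewrite ler_peMr // !addr_ge0.
Qed.

(** The two comparable monomials of [P] depend on the point, but there are only
    finitely many pairs, hence finitely many slopes. *)
Lemma root_asymptotics P : P != 0 ->
  exists (Q : seq R) (B t1 : R), [/\ 0 < t1, 0 <= B & forall t u,
    0 < t < t1 -> 0 < u -> eval2 P t u = 0 ->
    exists2 q, q \in Q & `|ln u - q * ln t| <= B].
Proof.
move=> P0.
pose s := msupp P.
have s0 : s != [::] by rewrite msupp_eq0.
have N0 : 0 < (size s)%:R :> R by rewrite ltr0n; case: (s) s0.
pose a m := `|ln `|mcoeff m P| |.
have [m0 _ hm0] := seq_argmax a s0.
pose B := ln (size s)%:R + a m0 + a m0.
pose i0 : 'I_2 := ord0; pose i1 : 'I_2 := lift ord0 ord0.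
have B0 : 0 <= B.
  rewrite !addr_ge0 // ?normr_ge0 // ln_ge0 // ler1n.
  by case: (s) s0.
pose q (m m' : multinom 2) : R :=
  ((m' i0)%:R - (m i0)%:R) / ((m i1)%:R - (m' i1)%:R).
exists [seq q m m' | m <- s, m' <- s], B, (expR (- B)); split=> //.
  exact: expR_gt0.
move=> t u /andP[t0 tB] u0.
have lnt : ln t < - B by rewrite -[ltRHS]expRK ltr_ln // posrE expR_gt0.
pose v m := mcoeff m P * (t ^+ m i0 * u ^+ m i1).
have c0 m : m \in s -> 0 < `|mcoeff m P| by rewrite normr_gt0 mcoeff_msupp.
have vE m : `|v m| = `|mcoeff m P| * (t ^+ m i0 * u ^+ m i1).
  by rewrite normrM [X in _ * X]ger0_norm // mulr_ge0 // exprn_ge0 // ltW.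
have v0 m : m \in s -> v m != 0.
  by move=> /c0 ?; rewrite -normr_gt0 vE !mulr_gt0 // exprn_gt0.
have lnv m : m \in s ->
    ln `|v m| = ln `|mcoeff m P| + (m i0)%:R * ln t + (m i1)%:R * ln u.
  move=> /c0 ?; rewrite vE !lnM ?posrE ?mulr_gt0 ?exprn_gt0 //.
  by rewrite !lnXn // !mulr_natl addrA.
move=> Ptu.
have : \sum_(m <- s) v m = 0.
  apply: etrans Ptu; rewrite /eval2 mevalE; apply: eq_bigr => m _.
  by rewrite big_ord_recl big_ord_recl big_ord0 mulr1.
move=> /(comparable_pair (msupp_uniq P) s0 v0)[m [m' [ms m's mm' /andP[h1 h2]]]].
have {}h1 : ln `|v m'| <= ln `|v m| by rewrite ler_ln // posrE normr_gt0 v0.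
have {h2} : ln `|v m| <= ln (size s)%:R + ln `|v m'|.
  by rewrite -lnM ?posrE ?normr_gt0 ?v0 // ler_ln ?posrE ?mulr_gt0 ?normr_gt0 ?v0.
move: h1; rewrite !lnv //.
have N1 : 0 <= ln (size s)%:R :> R by apply: ln_ge0; rewrite ler1n; case: (s) s0.
move=> h1 h2; exists (q m m'); first by apply/allpairsP; exists (m, m').
have ne : (m i0 != m' i0) || (m i1 != m' i1).
  apply: contraR mm'; rewrite negb_or !negbK => /andP[/eqP e0 /eqP e1].
  apply/eqP/mnmP => i.
  have [->//|->//] : i = i0 \/ i = i1.
  by case: i => -[|[|]] // ?; [left|right]; apply: val_inj.
exact: (slope_estimate N1 (hm0 _ m's) (hm0 _ ms) h1 h2 ne lnt).
Qed.

(** The finitely many [q] that are not frequent are excluded near zero. *)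
Lemma eventually_frequent (Q : seq R) (A : R -> R -> Prop) :
  exists2 e, 0 < e & forall t, 0 < t < e -> forall q, q \in Q -> A q t ->
    forall e', 0 < e' -> exists2 t', 0 < t' < e' & A q t'.
Proof.
elim: Q => [|q Q [e e0 he]]; first by exists 1.
have [hq|/existsNP[e' /not_implyP[e'0 hq]]] :=
    pselect (forall e', 0 < e' -> exists2 t', 0 < t' < e' & A q t').
  by exists e => // t /he h q'; rewrite inE => /orP[/eqP-> _|/h].
exists (Num.min e e'); first by rewrite lt_min e0.
move=> t; rewrite lt_min => /and3P[t0 te te'] q'; rewrite inE => /orP[/eqP->|q'Q].
  by move=> h; case: hq; exists t; rewrite ?t0.
by apply: he => //; rewrite t0.
Qed.

(** The exponent is the inverse of the smallest slope [q] that occurs arbitrarily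
    close to zero. Near zero every slope that occurs is at least [q], which
    gives the inequality; along the points where [q] occurs no smaller exponent
    is possible. *)
Lemma least_exponent (h : R -> R) (D : R) P : P != 0 ->
  (forall t, 0 < t -> 0 < h t <= D) ->
  (forall e, 0 < e -> exists2 d, 0 < d & forall t, 0 < t < d -> h t < e) ->
  (forall t, 0 < t -> eval2 P t (h t) = 0) ->
  let A := [set L : R | 0 < L /\
    exists2 c : R, 0 <= c & forall t : R, 0 < t -> h t `^ L <= c * t] in
  exists2 L, A L & lbound A L.
Proof.
move=> P0 hpos hlim hP A.
have [Q [B [t1 [t10 B0 hQ]]]] := root_asymptotics P0.
pose near q t := `|ln (h t) - q * ln t| <= B.
have [e e0 he] := eventually_frequent Q near.
pose t2 := Num.min (Num.min e t1) 1.
have t20 : 0 < t2 by rewrite !lt_min e0 t10 ltr01.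
pose freq q := forall e', 0 < e' -> exists2 t', 0 < t' < e' & near q t'.
have hfreq t : 0 < t < t2 -> exists q, [/\ q \in Q, freq q & near q t].
  rewrite !lt_min => /andP[t0 /andP[/andP[te tt1] _]].
  have /andP[h0 _] := hpos _ t0.
  have [|q qQ hq] := hQ t _ _ h0 (hP _ t0); first by rewrite t0.
  by exists q; split=> // e' e'0; apply: (he t) => //; rewrite t0.
have [|q [qQ qfreq qmin]] := @seq_argmin_prop Q freq.
  have [|q [qQ ? _]] := hfreq (t2 / 2); last by exists q.
  by rewrite divr_gt0 //= ltr_pdivrMr // ltr_pMr // ltr1n.
(* A slope [q <= 0] would keep [h] away from 0. *)
have q0 : 0 < q.
  rewrite ltNge; apply/negP => q0.
  have [d d0 hd] := hlim _ (expR_gt0 (- B)).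
  have [|t /andP[t0]] := qfreq (Num.min d 1); first by rewrite lt_min d0 ltr01.
  rewrite lt_min => /andP[td t1'].
  rewrite /near ler_norml => /andP[hq _].
  have /andP[h0 _] := hpos _ t0.
  have : h t < expR (- B) by apply: hd; rewrite t0.
  rewrite -ltr_ln ?posrE ?expR_gt0 // expRK ltNge => /negP; apply.
  have lt0 : 0 <= q * ln t by rewrite mulr_le0 // ltW // ln_lt0 // t0.
  by rewrite -(lerD2r (- (q * ln t))); apply: le_trans hq; rewrite gerDl oppr_le0.
have upper t : 0 < t < t2 -> ln (h t) <= q * ln t + B.
  move=> ht; have [q' [q'Q q'freq]] := hfreq _ ht.
  rewrite /near ler_norml lerBlDr => /andP[_] h1; apply: le_trans h1 _.
  rewrite addrC lerD2r ler_wnM2r ?qmin //.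
  move: ht; rewrite !lt_min => /andP[t0 /andP[_ tl1]].
  by rewrite ltW // ln_lt0 // t0.
have D0 : 0 <= D by have /andP[/ltW h1 h2] := hpos _ ltr01; exact: le_trans h2.
exists q^-1.
- split; first by rewrite invr_gt0.
  exists (expR (B / q) + D `^ q^-1 / t2).
    by rewrite addr_ge0 ?divr_ge0 ?powR_ge0 ?expR_ge0 // ltW.
  move=> t t0; have /andP[h0 hD] := hpos _ t0.
  have [tt2|tt2] := ltrP t t2.
    apply: (@le_trans _ _ (expR (B / q) * t)); last first.
      by rewrite ler_pM2r // lerDl divr_ge0 ?powR_ge0 // ltW.
    rewrite -[leLHS]lnK ?posrE ?powR_gt0 // -[X in _ * X]lnK //.
    rewrite -expRD ler_expR ln_powR.
    have /upper h1 : 0 < t < t2 by rewrite t0.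
    rewrite mulrC ler_pdivrMr //; apply: le_trans h1 _.
    by rewrite mulrDl mulfVK ?gt_eqF // addrC [ln t * q]mulrC.
  apply: (@le_trans _ _ (D `^ q^-1 / t2 * t)); last first.
    by rewrite ler_pM2r // lerDr expR_ge0.
  apply: (@le_trans _ _ (D `^ q^-1)).
    by rewrite ge0_ler_powR // ?nnegrE ?(ltW h0) // ltW // invr_gt0.
  by rewrite mulrAC ler_pdivlMr // ler_wpM2l // powR_ge0.
- move=> L [L0 [c c0 hc]]; rewrite leNgt; apply/negP => Lq.
  have Lq1 : 0 < 1 - L * q by rewrite subr_gt0 -ltr_pdivlMr // div1r.
  (* Where [q] occurs below [expR (- K)], [h t `^ L] exceeds [c * t]. *)
  pose K := (ln (c + 1) + L * B) / (1 - L * q).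
  have [|t /andP[t0]] := qfreq (Num.min (expR (- K)) 1).
    by rewrite lt_min expR_gt0 ltr01.
  rewrite lt_min => /andP[tK t1'].
  rewrite /near ler_norml => /andP[hq _].
  have /andP[h0 _] := hpos _ t0.
  have h1 : L * ln (h t) <= ln (c + 1) + ln t.
    have c10 : 0 < c + 1 by rewrite ltr_wpDl.
    rewrite -ln_powR -lnM ?posrE // ler_ln ?posrE ?powR_gt0 ?mulr_gt0 //.
    by apply: le_trans (hc _ t0) _; rewrite ler_pM2r // lerDl.
  have {tK} : ln t < - K by rewrite -[ltRHS]expRK ltr_ln // posrE expR_gt0.
  apply/negP; rewrite -leNgt lerNl /K ler_pdivlMr //.
  have : L * (- B) <= L * (ln (h t) - q * ln t) by rewrite ler_pM2l.
  move: h1; clear; set x := ln t; set y := ln (h t); set z := ln (c + 1); nra.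
Qed.

End LeastExponent.

(** * Existence of the least Lojasiewicz exponent *)

Section LojasiewiczExponent.
Variables (R : realType) (n m : nat) (g : m.-tuple (mpoly n R)).
Let S := basic_set g.
Hypotheses (S0 : S !=set0) (S_cube : S `<=` @cube R n).
Implicit Types (x y : 'rV[R]_n) (t u : R).

Local Notation var i := (GRing.Var R i).
Local Notation le := (@ord.Le R).
Local Notation "f '&&&' h" := (ord.And f h)
  (at level 40, left associativity).

Definition implication_formula : ord.formula R :=
  ord.Implies
    (conj_formula [seq le (GRing.NatConst R 0) (mpoly_term (2 + n) (tnth g j))
                  | j <- enum 'I_m])
    (le (GRing.Exp (var 1) 2)
      (sum_term [seq GRing.Exp (GRing.Add (var (2 + nat_of_ord i))
                     (GRing.Opp (var (2 + n + nat_of_ord i)))) 2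
                | i <- index_enum 'I_n])).

(** A point of the cube with violation at most [t] and distance at least [u] to
    [S] exists. Variable 0 is [t] and variable 1 is [u]; the point of the cube
    occupies the variables from 2 on and the point of [S] those from [2 + n]
    on. *)
Definition distance_formula : ord.formula R :=
  foldr (@ord.Exists R)
    (conj_formula [seq le (GRing.Opp (GRing.NatConst R 1)) (var (2 + nat_of_ord i)) &&&
                       le (var (2 + nat_of_ord i)) (GRing.NatConst R 1)
                  | i <- enum 'I_n] &&&
     conj_formula [seq le (GRing.Opp (mpoly_term 2 (tnth g j))) (var 0)
                  | j <- enum 'I_m] &&&
     foldr (@ord.Forall R) implication_formula (iota (2 + n) n))
    (iota 2 n).

Lemma holds_distance_formula t u :
  ord.holds [:: t; u] distance_formula <->
  exists x, [/\ cube x, forall j, - peval (tnth g j) x <= t &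
    forall y, S y -> u ^+ 2 <= \sum_i (x - y) ord0 i ^+ 2].
Proof.
rewrite /distance_formula holds_exists_row.
have varx x (i : 'I_n) : (bind_row [:: t; u] 2 x)`_(2 + i) = x ord0 i.
  exact: nth_bind_row_var.
have var0 x : (bind_row [:: t; u] 2 x)`_0 = t by rewrite nth_bind_row.
have hx x : ord.holds (bind_row [:: t; u] 2 x)
    (foldr (@ord.Forall R) implication_formula (iota (2 + n) n)) <->
    forall y, S y -> u ^+ 2 <= \sum_i (x - y) ord0 i ^+ 2.
  rewrite holds_forall_row; set e1 := bind_row _ 2 x.
  have vary y (i : 'I_n) : (bind_row e1 (2 + n) y)`_(2 + n + i) = y ord0 i.
    exact: nth_bind_row_var.
  have varx' y (i : 'I_n) : (bind_row e1 (2 + n) y)`_(2 + i) = x ord0 i.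
    by rewrite nth_bind_row leqNgt ltn_add2l ltn_ord; exact: varx.
  have var1 y : (bind_row e1 (2 + n) y)`_1 = u.
    by rewrite nth_bind_row /e1 nth_bind_row.
  have E y : ord.holds (bind_row e1 (2 + n) y) implication_formula <->
      (S y -> u ^+ 2 <= \sum_i (x - y) ord0 i ^+ 2).
    rewrite /implication_formula; set hyp := conj_formula _; set T := sum_term _.
    have hS : ord.holds (bind_row e1 (2 + n) y) hyp <-> S y.
      rewrite holds_conj_ord; split=> h j; have := h j;
        by rewrite /= (eval_mpoly_term _ (vary y)).
    have hT : GRing.eval (bind_row e1 (2 + n) y) T = \sum_i (x - y) ord0 i ^+ 2.
      rewrite eval_sum_term big_map; apply: eq_bigr => i _.
      by rewrite !mxE -(varx' y i) -(vary y i).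
    have -> : ord.holds (bind_row e1 (2 + n) y)
        (ord.Implies hyp (le (GRing.Exp (var 1) 2) T)) =
      (ord.holds (bind_row e1 (2 + n) y) hyp ->
       (bind_row e1 (2 + n) y)`_1 ^+ 2 <= GRing.eval (bind_row e1 (2 + n) y) T) by [].
    by rewrite var1 hT; split=> h ?; apply: h; apply/hS.
  by split=> h y; apply/E/h.
split=> -[x].
  move=> [[/holds_conj_ord h1 /holds_conj_ord h2] /hx h3].
  exists x; split=> // [i|j].
    have e2 : (bind_row [:: t; u] 2 x)`_i.+2 = x ord0 i by exact: varx.
    by have /= := h1 i; rewrite e2 => -[-> ->].
  by have := h2 j; rewrite /= (eval_mpoly_term _ (varx x)) var0.
move=> [h1 h2 h3]; exists x; split; first split.
- apply/holds_conj_ord => i.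
  have /andP[a b] := h1 i.
  have e2 : (bind_row [:: t; u] 2 x)`_i.+2 = x ord0 i by exact: varx.
  by split; rewrite /= e2.
- by apply/holds_conj_ord => j; rewrite /= (eval_mpoly_term _ (varx x)) var0.
- exact/hx.
Qed.

Definition max_dist t : R :=
  sup [set eucl_dist x S | x in [set x | cube x /\ violation g x <= t]].

Let D : R := Num.sqrt (4 * n%:R).

Let dist_has_sup t : 0 <= t ->
  has_sup [set eucl_dist x S | x in [set x | cube x /\ violation g x <= t]].
Proof.
move=> t0; split.
  have [s Ss] := S0; exists (eucl_dist s S), s => //; split; first exact: S_cube.
  by apply/violation_leP; split=> // j; apply: le_trans t0; rewrite oppr_le0; exact: Ss.
by exists D => _ [x [cx _] <-]; exact: eucl_dist_cube.
Qed.

Lemma max_dist_ge t x : 0 <= t -> cube x -> violation g x <= t ->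
  eucl_dist x S <= max_dist t.
Proof.
move=> t0 cx xt; apply: sup_upper_bound; first exact: dist_has_sup.
by exists x.
Qed.

Lemma max_dist_le t c : 0 <= t ->
  (forall x, cube x -> violation g x <= t -> eucl_dist x S <= c) -> max_dist t <= c.
Proof.
move=> t0 h; apply: ge_sup; first by have [] := dist_has_sup t0.
by move=> _ [x [cx xt] <-]; exact: h.
Qed.

(** Positive numbers just below the supremum satisfy the formula, and numbers
    above it do not. *)
Lemma max_dist_boundary t : 0 < t -> 0 < max_dist t ->
  forall e, 0 < e -> exists u1 u2,
    [/\ `|u1 - max_dist t| < e, `|u2 - max_dist t| < e,
     ord.holds [:: t; u1] distance_formula &
     ~ ord.holds [:: t; u2] distance_formula].
Proof.
move=> t0 h0 e e0; set h := max_dist t in h0 *.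
pose d := Num.min e h / 2.
have m0 : 0 < Num.min e h by rewrite lt_min e0.
have d0 : 0 < d by rewrite divr_gt0.
have dm : d < Num.min e h by rewrite /d ltr_pdivrMr // ltr_pMr // ltr1n.
move: dm; rewrite lt_min => /andP[de dh].
have sqdistE x y : \sum_i (x - y) ord0 i ^+ 2 = eucl_norm (x - y) ^+ 2.
  by rewrite /eucl_norm sqr_sqrtr // sumr_ge0 // => i _; exact: sqr_ge0.
exists (h - d), (h + d); split.
- by rewrite addrAC subrr add0r normrN gtr0_norm.
- by rewrite addrAC subrr add0r gtr0_norm.
- apply/holds_distance_formula.
  have [_ [x [cx xt] <-] hx] := sup_adherent d0 (dist_has_sup (ltW t0)).
  exists x; split=> //; first by have /violation_leP[] := xt.
  move=> y Sy; rewrite sqdistE lerXn2r ?nnegrE ?eucl_norm_ge0 //.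
    by rewrite subr_ge0 ltW.
  by apply: le_trans (ltW hx) _; exact: eucl_dist_le.
move=> /holds_distance_formula[x [cx xt hx]].
have xt' : violation g x <= t by apply/violation_leP; split=> //; exact: ltW.
have := max_dist_ge (ltW t0) cx xt'; rewrite leNgt => /negP; apply.
apply: (@lt_le_trans _ _ (h + d)); first by rewrite ltrDl.
apply/(eucl_dist_geP S0) => y Sy.
rewrite -(@ler_pXn2r _ 2) ?nnegrE ?eucl_norm_ge0 //; last first.
  by rewrite addr_ge0 ?ltW.
by rewrite -sqdistE; exact: hx.
Qed.

Lemma exponent_degenerate L : @cube R n `<=` S -> 0 < L -> lojasiewicz_exponent g L.
Proof.
move=> cS L0; split=> //; exists 0 => // x cx.
by rewrite (eucl_dist_mem S0 (cS _ cx)) powR0 ?mul0r // gt_eqF.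
Qed.

(** Were the supremum zero for some positive [t], every positive number would be
    an exponent, contrary to [exponent_ge1]. *)
Lemma max_dist_gt0 t : ~ (@cube R n `<=` S) -> 0 < t -> 0 < max_dist t.
Proof.
move=> nd t0; rewrite ltNge; apply/negP => h0.
suff : lojasiewicz_exponent g 2^-1.
  move=> /(exponent_ge1 S0 S_cube nd); rewrite invf_ge1 //.
  by rewrite leNgt ltr1n.
split; first by rewrite invr_gt0.
exists (D `^ 2^-1 / t); first by rewrite divr_ge0 ?powR_ge0 // ltW.
move=> x cx; have [xt|xt] := lerP (violation g x) t.
  have -> : eucl_dist x (basic_set g) = 0.
    apply/eqP; rewrite eq_le eucl_dist_ge0 // andbT.
    exact: le_trans (max_dist_ge (ltW t0) cx xt) h0.
  rewrite powR0 ?invr_neq0 // mulr_ge0 ?violation_ge0 //.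
  by rewrite divr_ge0 ?powR_ge0 // ltW.
apply: (@le_trans _ _ (D `^ 2^-1)).
  apply: ge0_ler_powR; rewrite ?invr_ge0 ?nnegrE ?eucl_dist_ge0 ?sqrtr_ge0 //.
  exact: eucl_dist_cube.
by rewrite mulrAC ler_pdivlMr // ler_wpM2l ?powR_ge0 // ltW.
Qed.

(** The inequality only has to be tested at the worst points of each level of
    violation, which reduces it to a function of one variable. *)
Lemma exponentP L : 0 < L -> lojasiewicz_exponent g L <->
  exists2 c : R, 0 <= c & forall t, 0 < t -> max_dist t `^ L <= c * t.
Proof.
move=> L0; have L1 : 0 < L^-1 by rewrite invr_gt0.
have h0 t : 0 <= t -> 0 <= max_dist t.
  move=> t0; have [s Ss] := S0.
  rewrite -(eucl_dist_mem S0 Ss); apply: max_dist_ge => //; first exact: S_cube.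
  by apply/violation_leP; split=> // j; apply: le_trans t0; rewrite oppr_le0; exact: Ss.
split=> [[_ [c c0 h]]|[c c0 h]].
  exists c => // t t0; have ct : 0 <= c * t by rewrite mulr_ge0 // ltW.
  have -> : c * t = ((c * t) `^ L^-1) `^ L.
    by rewrite -powRrM mulVf ?gt_eqF // powRr1.
  apply: (ge0_ler_powR (ltW L0)); rewrite ?nnegrE ?powR_ge0 ?h0 ?(ltW t0) //.
  apply: max_dist_le => [|x cx xt]; first exact: ltW.
  have -> : eucl_dist x S = (eucl_dist x S `^ L) `^ L^-1.
    by rewrite -powRrM mulfV ?gt_eqF // powRr1 // eucl_dist_ge0.
  apply: (ge0_ler_powR (ltW L1)); rewrite ?nnegrE ?powR_ge0 //.
  by apply: le_trans (h _ cx) _; rewrite ler_wpM2l.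
split=> //; exists c => // x cx.
have [x0|x0] := lerP (violation g x) 0.
  rewrite (eucl_dist_mem S0) ?powR0 ?gt_eqF ?mulr_ge0 ?violation_ge0 //.
  exact: violation_le0.
apply: le_trans (h _ x0); apply: (ge0_ler_powR (ltW L0));
  rewrite ?nnegrE ?eucl_dist_ge0 ?h0 ?violation_ge0 //.
by apply: max_dist_ge; rewrite ?violation_ge0.
Qed.

Lemma least_exponent_exists : ~ (@cube R n `<=` S) ->
  exists2 L, lojasiewicz_exponent g L & lbound (lojasiewicz_exponent g) L.
Proof.
move=> nd; have [P P0 hP] := definable_boundary distance_formula.
have [t t0|e e0|t t0|L [L0 hL] Lmin] := @least_exponent R max_dist D P P0.
- rewrite max_dist_gt0 //=; apply: max_dist_le => [|x cx _]; first exact: ltW.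
  exact: eucl_dist_cube.
- have [|d d0 hd] := @eucl_dist_small _ _ _ g S0 (e / 2); first by rewrite divr_gt0.
  exists d => // t /andP[t0 td]; apply: (@le_lt_trans _ _ (e / 2)).
    apply: max_dist_le => [|x cx xt]; first exact: ltW.
    by apply/ltW/hd => //; exact: le_lt_trans td.
  by rewrite ltr_pdivrMr // ltr_pMr // ltr1n.
- by apply: hP; apply: max_dist_boundary => //; exact: max_dist_gt0.
exists L; first exact/exponentP.
move=> L' hL'; have L'0 : 0 < L' by case: hL'.
by apply: Lmin; split=> //; exact/exponentP.
Qed.

(** If the cube is contained in the feasible set, half of an exponent is again an
    exponent, so there is no least one and the conventional value is taken. *)
Lemma lojasiewiczP : 1 <= lojasiewicz g /\ lojasiewicz_exponent g (lojasiewicz g).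
Proof.
rewrite /lojasiewicz /least; set A := [set L | _].
have [cS|nd] := pselect (@cube R n `<=` S).
  rewrite xgetPN.
    by split=> //; exact: exponent_degenerate.
  move=> L [[L0 _] Lmin].
  have /Lmin : A (L / 2) by apply: exponent_degenerate => //; rewrite divr_gt0.
  by rewrite leNgt ltr_pdivrMr // ltr_pMr // ltr1n.
have [L hL Lmin] := least_exponent_exists nd.
case: (xgetP 1 (A `&` lbound A)) => [L' _ [hL' _]|/(_ L)[]].
  by split=> //; exact: (exponent_ge1 S0 S_cube nd).
by split.
Qed.

End LojasiewiczExponent.

(** * Lifting to a positive polynomial in more variables *)

Section Extrema.
Variables (R : realType) (n : nat).
Implicit Types (f : mpoly n R) (x : 'rV[R]_n) (S : set 'rV[R]_n).

Lemma sup_norm_ge f x : cube x -> `|peval f x| <= sup_norm f.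
Proof.
move=> cx; apply: sup_upper_bound; last by exists x.
split; first by exists `|peval f x|, x.
have [w hw] := coef_boundedP f.
by exists w => _ [y cy <-]; exact: coef_bounded_eval hw cy.
Qed.

Lemma min_onP f S : S !=set0 -> compact S ->
  (exists2 x, S x & min_on f S = peval f x) /\
  forall x, S x -> min_on f S <= peval f x.
Proof.
move=> [x0 Sx0] cS.
have [|c] := compact_EVT_min (ex_intro _ x0 Sx0) cS (f := peval f).
  exact/continuous_subspaceT/continuous_peval.
rewrite inE => Sc hc.
rewrite /min_on /least.
set A := [set peval f x | x in S].
have hA : (A `&` lbound A) (peval f c).
  split; first by exists c.
  by move=> _ [x Sx <-]; apply: hc; rewrite inE.
case: xgetP => [y _ [[x Sx <-] h]|/(_ (peval f c))//].
by split; [exists x|move=> z Sz; apply: h; exists z].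
Qed.

End Extrema.

Section Estimates.
Variable R : realType.

Lemma bin_le_expn2 k i : ('C(k, i) <= 2 ^ k)%N.
Proof.
elim: k i => [|k IH] [|i]; rewrite ?bin0 ?bin0n ?expn_gt0 //.
by rewrite binS expnS mul2n -addnn leq_add.
Qed.

Lemma expn_le_exp2 P d : (d.+1 ^ P <= P`! * 2 ^ (d + P))%N.
Proof.
apply: (@leq_trans ((d + P) ^_ P)).
  rewrite ffact_prod -[X in (d.+1 ^ X)%N](card_ord P) -prod_nat_const.
  by apply: leq_prod => i _; have := ltn_ord i; lia.
by rewrite -bin_ffact mulnC leq_mul2l bin_le_expn2 orbT.
Qed.

(** [d.+1 ^ P] is at most the product of the integers from [d + 1] to [d + P],
    that is [P`!] times a binomial coefficient, and [2 * 7 <= 60]. *)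
Lemma poly_exp_absorb (P d : nat) :
  d.+1%:R ^+ P * 7 ^+ d <= (P`!)%:R * 2 ^+ P * 60 ^+ d :> R.
Proof.
apply: (@le_trans _ _ ((P`!)%:R * 2 ^+ P * 2 ^+ d * 7 ^+ d)).
  rewrite ler_wpM2r ?exprn_ge0 // -!natrX -!natrM ler_nat -mulnA -expnD addnC.
  exact: expn_le_exp2.
rewrite -mulrA -exprMn; apply: ler_wpM2l.
  by rewrite mulr_ge0 ?exprn_ge0.
by rewrite lerXn2r ?nnegrE -?natrM ?ler_nat.
Qed.

(** With [b = 2 * l / e], the loss [l * t] is [e / 2 * (b * t)] and the penalty is
    [e / 2 * (b * t) `^ (2 * L)]. The penalty exceeds the loss when
    [1 <= b * t], and otherwise the loss is at most [e / 2]. *)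
Lemma penalty_bound (L e l t : R) : 1 <= L -> 0 < e -> 0 < l -> 0 <= t ->
  e / 2 <= e - l * t + e / 2 * (2 * l / e) `^ (2 * L) * (t `^ L) ^+ 2.
Proof.
move=> L1 e0 l0 t0; pose b := 2 * l / e.
have b0 : 0 <= b by rewrite /b divr_ge0 ?mulr_ge0 // ltW.
have ebt : l * t = e / 2 * (b * t).
  by rewrite /b; field; rewrite gt_eqF.
have -> : (t `^ L) ^+ 2 = t `^ (2 * L).
  by rewrite -powR_mulrn ?powR_ge0 // -powRrM mulrC.
rewrite -mulrA -/b -powRM //.
have bt0 : 0 <= b * t by rewrite mulr_ge0.
rewrite ebt; have [h|h] := lerP (b * t) 1.
  have := powR_ge0 (b * t) (2 * L).
  move: ((b * t) `^ (2 * L)) (b * t) h bt0 e0 => p q; clear; nra.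
have : (b * t) <= (b * t) `^ (2 * L).
  rewrite -{1}[b * t]powRr1 //; apply: ler_powR; first exact: ltW.
  by move: L1; clear; lra.
move: ((b * t) `^ (2 * L)) (b * t) h bt0 e0 => p q; clear; nra.
Qed.

End Estimates.

Section Lift.
Variables (R : realType) (n m : nat) (g : m.-tuple (mpoly n R)) (M : R).
Hypothesis M0 : 0 < M.

Definition to_cube : n.-tuple (mpoly (n + m) R) :=
  [tuple (2 : R) *: pvar R (lshift m i) - 1 | i < n].

Definition lift_slack (j : 'I_m) : mpoly (n + m) R :=
  pvar R (rshift n j) - M^-1 *: comp_mpoly to_cube (tnth g j).

(** The substitution [graph] kills the penalty, so this polynomial in [n + m]
    variables restricts to [f]. *)
Definition lift (A : R) (f : mpoly n R) : mpoly (n + m) R :=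
  comp_mpoly to_cube f + A *: \sum_j lift_slack j ^+ 2.

Definition graph : (n + m).-tuple (mpoly n R) :=
  [tuple match fintype.split l with
         | inl i => 2^-1 *: (1 + pvar R i)
         | inr j => M^-1 *: tnth g j
         end | l < n + m].

Lemma tnth_graph_l i : tnth graph (lshift m i) = 2^-1 *: (1 + pvar R i).
Proof. by rewrite tnth_mktuple (unsplitK (inl i)). Qed.

Lemma tnth_graph_r j : tnth graph (rshift n j) = M^-1 *: tnth g j.
Proof. by rewrite tnth_mktuple (unsplitK (inr j)). Qed.

Lemma comp_graph_to_cube (p : mpoly n R) :
  comp_mpoly graph (comp_mpoly to_cube p) = p.
Proof.
rewrite [RHS]mpolyE (comp_mpolyEX p) raddf_sum; apply: eq_bigr => k _ /=.
rewrite comp_mpolyZ comp_mpolyX rmorph_prod mpolyXE_id /=; congr (_ *: _).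
apply: eq_bigr => i _.
rewrite (rmorphXn (comp_mpoly graph)) tnth_mktuple (rmorphB (comp_mpoly graph)) /=.
rewrite comp_mpolyZ comp_pvar comp_mpoly1 tnth_graph_l scalerA mulfV ?pnatr_eq0 //.
by rewrite scale1r addrC addKr.
Qed.

Lemma comp_graph_lift A f : comp_mpoly graph (lift A f) = f.
Proof.
rewrite /lift (rmorphD (comp_mpoly graph)) /= comp_graph_to_cube comp_mpolyZ.
rewrite (rmorph_sum (comp_mpoly graph)) /=.
rewrite big1 ?scaler0 ?addr0 // => j _.
have e : comp_mpoly graph (lift_slack j) = 0.
  rewrite /lift_slack (rmorphB (comp_mpoly graph)) /= comp_mpolyZ.
  by rewrite comp_graph_to_cube comp_pvar tnth_graph_r subrr.
by rewrite expr2 (rmorphM (comp_mpoly graph)) /= e mul0r.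
Qed.

Definition cube_point (w : 'rV[R]_(n + m)) : 'rV[R]_n :=
  \row_i (2 * w ord0 (lshift m i) - 1).

Lemma peval_to_cube (p : mpoly n R) w :
  peval (comp_mpoly to_cube p) w = peval p (cube_point w).
Proof.
rewrite /peval comp_mpoly_meval; apply: meval_eq => i.
by rewrite tnth_mktuple mevalB mevalZ mevalXU meval1 mxE.
Qed.

Lemma peval_lift A f w : peval (lift A f) w = peval f (cube_point w) +
  A * \sum_j (w ord0 (rshift n j) - M^-1 * peval (tnth g j) (cube_point w)) ^+ 2.
Proof.
rewrite /lift /peval mevalD mevalZ -!/(peval _ _) peval_to_cube.
congr (_ + _ * _); rewrite /peval raddf_sum /=; apply: eq_bigr => j _.
by rewrite rmorphXn /= mevalB mevalXU mevalZ -!/(peval _ _) peval_to_cube.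
Qed.

(** As [y j] is nonnegative, [y j - g_j x / M] is at least [- g_j x / M]. *)
Lemma violation_le_penalty x (y : 'I_m -> R) : (forall j, 0 <= y j) ->
  violation g x ^+ 2 <= M ^+ 2 * \sum_j (y j - M^-1 * peval (tnth g j) x) ^+ 2.
Proof.
move=> y0; set Q := \sum_j _.
have Q0 : 0 <= Q by apply: sumr_ge0 => j _; exact: sqr_ge0.
rewrite -(sqr_sqrtr Q0) -exprMn lerXn2r ?nnegrE ?violation_ge0 //.
  by rewrite mulr_ge0 ?sqrtr_ge0 // ltW.
apply/violation_leP; split=> [|j]; first by rewrite mulr_ge0 ?sqrtr_ge0 // ltW.
rewrite -ler_pdivrMl // mulrN; set z := M^-1 * _.
apply: (@le_trans _ _ (y j - z)); first by rewrite lerDr.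
apply: le_trans (ler_norm _) _; rewrite -sqrtr_sqr ler_wsqrtr //.
by rewrite /Q (bigD1 j) //= lerDl sumr_ge0 // => i _; exact: sqr_ge0.
Qed.

Lemma lift_ge f (e l c L : R) : basic_set g !=set0 -> basic_set g `<=` @cube R n ->
  1 <= L -> 0 < c -> 0 < e -> 0 < l ->
  (forall x, cube x -> eucl_dist x (basic_set g) `^ L <= c * violation g x) ->
  (forall x, basic_set g x -> e <= peval f x) ->
  (forall x y, cube x -> cube y ->
    `|peval f x - peval f y| <= l * eucl_norm (x - y)) ->
  forall w : 'rV[R]_(n + m), (forall k, 0 <= w ord0 k <= 1) ->
  e / 2 <= peval (lift (e / 2 * (2 * l / e) `^ (2 * L) * (c * M) ^+ 2) f) w.
Proof.
move=> S0 S_cube L1 c0 e0 l0 hL he hl w hw.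
have cx : cube (cube_point w).
  move=> i; rewrite mxE; have /andP[] := hw (lshift m i).
  by move: (w _ _) => a a0 a1; apply/andP; split; lra.
rewrite peval_lift; set x := cube_point w in cx *.
pose t := eucl_dist x (basic_set g).
have t0 : 0 <= t by exact: eucl_dist_ge0.
have fx : e - l * t <= peval f x.
  rewrite lerBlDr -lerBlDl mulrC -ler_pdivrMr //; apply/(eucl_dist_geP S0) => y Sy.
  rewrite ler_pdivrMr // mulrC lerBlDr.
  have := hl _ _ cx (S_cube _ Sy); rewrite ler_norml => /andP[h _].
  by apply: le_trans (he _ Sy) _; rewrite -lerBlDr -opprB lerNl.
apply: le_trans (penalty_bound L1 e0 l0 t0) _; apply: lerD => //.
rewrite -[leRHS]mulrA ler_wpM2l //.
  by rewrite mulr_ge0 ?powR_ge0 // divr_ge0 // ltW.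
have := violation_le_penalty x (fun j => proj1 (andP (hw (rshift n j)))).
set Q := \sum_j _ => hQ; rewrite exprMn -mulrA.
apply: (@le_trans _ _ (c ^+ 2 * violation g x ^+ 2)); last first.
  by rewrite ler_wpM2l // sqr_ge0.
rewrite -exprMn lerXn2r ?nnegrE ?powR_ge0 //; last exact: hL.
by rewrite mulr_ge0 ?violation_ge0 // ltW.
Qed.

End Lift.

(** * Degree estimates *)

Section Assembly.
Variable R : realType.

Lemma addnS_le_muln (d E : nat) : ((d + E).+1 <= E.+1 * d.+1)%N.
Proof. by rewrite mulSn mulnS; lia. Qed.

(** The powers of [d] on the left, of which the real power [2 * L] is first
    rounded up to the integer [P], are gathered in one power of [d.+1] and
    absorbed by the exponential; a power of [k] below [2 * L] is absorbed
    because [1 <= k]. *)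
Lemma degree_estimate (n E : nat) (V L : R) : 0 <= V -> 1 <= L ->
  exists2 C : R, 0 < C & forall (d : nat) (k : R), 1 <= k ->
  (d.+1%:R ^+ n * (2 ^+ n * (2 * k) * 7 ^+ d) +
     V * (2 * (markov_const R n d * k)) `^ (2 * L)) * (d + E)%:R ^+ 2
    + (d + E).+1%:R <= C * 60 ^+ d * k `^ (2 * L).
Proof.
move=> V0 L1; have L0 : 0 <= 2 * L by move: L1; clear; lra.
have [P hP] : exists P : nat, 2 * L <= P%:R.
  by exists (Num.bound (2 * L)); exact/ltW/archi_boundP.
pose C1 : R := (2 * 2 ^+ n * n%:R) `^ (2 * L).
pose P2 := (n + (n + 2) * P + 2)%N.
pose B : R := (2 ^+ n.+1 + V * C1) * E.+1%:R ^+ 2 + E.+2%:R.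
have C10 : 0 <= C1 := powR_ge0 _ _.
have c0 : 0 <= 2 ^+ n.+1 + V * C1 by rewrite addr_ge0 ?exprn_ge0 ?mulr_ge0.
have B0 : 0 < B by rewrite ltr_wpDl // mulr_ge0 ?sqr_ge0.
exists (B * ((P2`!)%:R * 2 ^+ P2)).
  by rewrite !mulr_gt0 ?exprn_gt0 // ltr0n fact_gt0.
move=> d k k1.
have k0 : 0 <= k := le_trans ler01 k1.
set K := k `^ (2 * L).
have kK : k <= K.
  by rewrite /K -{1}[k]powRr1 // ler_powR //; move: L1; clear; lra.
have K1 : 1 <= K := le_trans k1 kK.
have K0 : 0 <= K := le_trans ler01 K1.
pose q : R := d.+1%:R.
have q1 : 1 <= q by rewrite ler1n.
have q0 : 0 <= q := le_trans ler01 q1.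
pose e7 : R := 7 ^+ d.
have e71 : 1 <= e7 by rewrite exprn_ege1 // ler1n.
have e70 : 0 <= e7 := le_trans ler01 e71.
have qX_le a b : (a <= b)%N -> q ^+ a <= q ^+ b.
  by move=> ab; rewrite ler_weXn2l.
have beta : (2 * (markov_const R n d * k)) `^ (2 * L) <= C1 * q ^+ ((n + 2) * P) * K.
  apply: (@le_trans _ _ ((2 * 2 ^+ n * n%:R * q ^+ (n + 2) * k) `^ (2 * L))).
    have mk0 : 0 <= markov_const R n d * k.
      by rewrite /markov_const !mulr_ge0 ?exprn_ge0.
    apply: ge0_ler_powR => //; rewrite ?nnegrE ?mulr_ge0 ?exprn_ge0 //.
    rewrite mulrA ler_wpM2r //.
    have -> : 2 * 2 ^+ n * n%:R * q ^+ (n + 2) = 2 * (q ^+ n * 2 ^+ n * (q ^+ 2 * n%:R)).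
      by rewrite exprD; ring.
    rewrite /markov_const -/q ler_wpM2l // ler_wpM2l ?mulr_ge0 ?exprn_ge0 //.
    by rewrite ler_wpM2r // lerXn2r ?nnegrE // ler_nat.
  rewrite powRM ?mulr_ge0 ?exprn_ge0 // powRM ?mulr_ge0 ?exprn_ge0 //.
  rewrite ler_wpM2r // ler_wpM2l //.
  apply: (@le_trans _ _ ((q ^+ (n + 2)) `^ P%:R)).
    by rewrite ler_powR // exprn_ege1.
  by rewrite powR_mulrn ?exprn_ge0 // -exprM.
have bracket : d.+1%:R ^+ n * (2 ^+ n * (2 * k) * 7 ^+ d) +
     V * (2 * (markov_const R n d * k)) `^ (2 * L) <=
     (2 ^+ n.+1 + V * C1) * (q ^+ (n + (n + 2) * P) * e7 * K).
  rewrite [leRHS]mulrDl; apply: lerD.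
    have -> : d.+1%:R ^+ n * (2 ^+ n * (2 * k) * 7 ^+ d) =
        2 ^+ n.+1 * (q ^+ n * e7 * k) by rewrite exprS /q /e7; ring.
    rewrite ler_wpM2l ?exprn_ge0 //.
    apply: ler_pM; rewrite ?mulr_ge0 ?exprn_ge0 //.
    by rewrite ler_wpM2r // qX_le // leq_addr.
  rewrite -mulrA ler_wpM2l //; apply: le_trans beta _.
  rewrite -mulrA ler_wpM2l // ler_wpM2r //.
  apply: (@le_trans _ _ (q ^+ (n + (n + 2) * P))); first by rewrite qX_le // leq_addl.
  by rewrite ler_peMr ?exprn_ge0.
have sq : (d + E)%:R ^+ 2 <= E.+1%:R ^+ 2 * q ^+ 2 :> R.
  rewrite -exprMn lerXn2r ?nnegrE ?mulr_ge0 // /q -natrM ler_nat.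
  exact: leq_trans (addnS_le_muln d E).
have rest : (d + E).+1%:R <= E.+2%:R * (q ^+ P2 * e7 * K) :> R.
  apply: (@le_trans _ _ (E.+2%:R * q)).
    rewrite /q -natrM ler_nat; apply: leq_trans (addnS_le_muln d E) _.
    by rewrite leq_mul2r leqnSn orbT.
  rewrite ler_wpM2l //; apply: (@le_trans _ _ (q ^+ P2)).
    by rewrite -{1}[q]expr1 qX_le // /P2 addn2.
  by rewrite -mulrA ler_peMr ?exprn_ge0 // mulr_ege1.
apply: (@le_trans _ _ (B * (q ^+ P2 * e7 * K))).
  rewrite [leRHS]mulrDl; apply: lerD rest.
  apply: (@le_trans _ _ ((2 ^+ n.+1 + V * C1) * (q ^+ (n + (n + 2) * P) * e7 * K) *
    (E.+1%:R ^+ 2 * q ^+ 2))).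
    apply: ler_pM => //; rewrite ?sqr_ge0 // addr_ge0 ?mulr_ge0 ?exprn_ge0 ?powR_ge0 //.
  rewrite le_eqVlt; apply/orP; left; apply/eqP.
  have -> : q ^+ P2 = q ^+ (n + (n + 2) * P) * q ^+ 2 by exact: exprD.
  by move: (q ^+ (n + _)) => X; ring.
rewrite -!mulrA ler_wpM2l ?(ltW B0) // !mulrA ler_wpM2r //.
exact: poly_exp_absorb.
Qed.

Variables (n m : nat) (g : m.-tuple (mpoly n R)).

Lemma to_cube_coef i : coef_bounded 1 3 (tnth (to_cube R n m) i).
Proof.
rewrite tnth_mktuple.
have -> : 3 = `|2| * 1 + `|1| :> R by rewrite normr_nat normr1; ring.
apply: coef_boundedB; last by rewrite -mpolyC1; exact: coef_boundedC.
by apply: coef_boundedZ; apply: coef_boundedX; rewrite mdeg1.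
Qed.

Lemma lift_coef_bounded (M : R) : exists (E : nat) (V : R), 0 <= V /\
  forall A f d N, (pdeg f <= d)%N -> (forall x, cube x -> `|peval f x| <= N) ->
  0 <= A ->
  coef_bounded (d + E) (d.+1%:R ^+ n * (2 ^+ n * N * 7 ^+ d) + A * V) (lift g M A f).
Proof.
pose p := \sum_j lift_slack g M j ^+ 2.
have [V hV] := coef_boundedP p.
exists (pdeg p), V; split; first exact: coef_bounded_ge0 hV.
move=> A f d N fd hN A0; apply: coef_boundedD.
  apply: (@coef_bounded_le _ _ d); [exact: leq_addr | exact: lexx |].
  exact: (coef_bounded_comp fd hN to_cube_coef).
rewrite -{1}(ger0_norm A0).
apply: (@coef_bounded_le _ _ (pdeg p)); [exact: leq_addl | exact: lexx |].
exact: coef_boundedZ.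
Qed.

Lemma preprime_graph (M : R) (D : nat) : 0 < M -> (0 < D)%N ->
  (forall j, (pdeg (tnth g j) <= D)%N) ->
  (forall j, coef_bounded (pdeg (tnth g j)) M (tnth g j)) ->
  let q := box_array R n ++ g in
  forall l, preprime q D%:R (tnth (graph g M) l) /\
            preprime q D%:R (1 - tnth (graph g M) l).
Proof.
move=> M0 D0 gD gM q l.
have box_q : {subset box_array R n <= q} by move=> p; rewrite mem_cat => ->.
have Mi : 0 <= M^-1 by rewrite invr_ge0 ltW.
rewrite -(splitK l); case: (fintype.split l) => [i|j] /=.
  rewrite tnth_graph_l; have [h1 h2] := preprime_box box_q i.
  have D1 : 1 <= D%:R :> R by rewrite ler1n.
  have half : 0 <= 2^-1 :> R by rewrite invr_ge0.
  split; first by apply: preprimeZ => //; exact: preprime_le h2.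
  have -> : 1 - 2^-1 *: (1 + pvar R i) = 2^-1 *: (1 - pvar R i) :> mpoly n R.
    have n2 : (2 : R) != 0 by rewrite pnatr_eq0.
    apply: (scalerI n2); rewrite scalerBr !scalerA mulfV // !scale1r scaler_nat.
    by ring.
  by apply: preprimeZ => //; exact: preprime_le h1.
rewrite tnth_graph_r.
have gq : tnth g j \in q by rewrite mem_cat mem_tnth orbT.
split.
  apply: preprimeZ => //; apply: preprime_le (preprime_mem gq).
  by rewrite ler_nat.
have -> : 1 - M^-1 *: tnth g j = M^-1 *: (mpolyC n M - tnth g j).
  rewrite scalerBr; congr (_ - _).
  by rewrite -[mpolyC n M]mulr1 mul_mpolyC scalerA mulVf ?scale1r // gt_eqF.
apply: preprimeZ => //; apply: preprime_le (preprime_coef_bounded box_q (gM j)).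
by rewrite ler_nat.
Qed.

End Assembly.

(** * The theorem *)

Lemma pdeg_le_max_deg (R : realType) (n m : nat) (g : m.-tuple (mpoly n R)) j :
  (pdeg (tnth g j) <= max_deg g)%N.
Proof. by rewrite /max_deg; exact: (leq_bigmax j). Qed.

Theorem theorem8 (R : realType) (n m : nat) (n_ge1 : (1 <= n)%N)
    (m_ge1 : (1 <= m)%N) (g : m.-tuple (mpoly n R))
    (g_nonempty : basic_set g !=set0)
    (g_compact : compact (basic_set g))
    (g_cube : basic_set g `<=` @cube R n) :
  exists2 C : R, 0 < C &
    forall (d : nat) (f : mpoly n R),
      pdeg f = d ->
      (forall x, basic_set g x -> 0 < peval f x) ->
      let L := lojasiewicz g in
      let r := C * 60 ^+ d * d%:R `^ (4 * L + 3)
                 * n%:R ^+ (2 * max_deg g * d)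
                 * kappa (basic_set g) f `^ (2 * L) in
      preprime (box_array R n ++ g) (r * (n + m)%:R) f.
Proof.
set S := basic_set g in g_nonempty g_compact g_cube *.
have [L1 [L0 [c0 c00 hc0]]] := lojasiewiczP g_nonempty g_cube.
set L := lojasiewicz g in L1 L0 hc0 *.
pose c := c0 + 1; have c_gt0 : 0 < c by rewrite ltr_wpDl.
have hc x : cube x -> eucl_dist x S `^ L <= c * violation g x.
  by move=> /hc0 h; apply: le_trans h _; rewrite ler_wpM2r ?violation_ge0 // lerDl.
have [w hw] := choice (fun j => coef_boundedP (tnth g j)).
pose M := 1 + \sum_j w j.
have w0 j : 0 <= w j := coef_bounded_ge0 (hw j).
have M0 : 0 < M by rewrite ltr_wpDr // sumr_ge0.
have gM j : coef_bounded (pdeg (tnth g j)) M (tnth g j).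
  apply: coef_bounded_le (hw j) => //.
  by rewrite /M (bigD1 j) //= addrCA lerDl addr_ge0 // sumr_ge0.
pose D := (max_deg g).+1.
have [E [V [V0 hV]]] := lift_coef_bounded g M.
have cMV : 0 <= (c * M) ^+ 2 * V by rewrite mulr_ge0 ?sqr_ge0.
have [C C0 hC] := degree_estimate n E cMV L1.
exists (C * D%:R); first by rewrite mulr_gt0 // ltr0n.
move=> d f fd f0 /=.
set k := kappa S f.
(* For [d = 0] the allowed degree is 0, and [f] is a positive constant. *)
case: d fd => [|d'] fd.
  have -> : f = mpolyC n (mcoeff mnm0 f).
    by apply: msize1_polyC; move: fd; rewrite /pdeg; case: (mmeasure _ f) => [|[]].
  apply: preprimeC.
    by rewrite !mulr_ge0 ?exprn_ge0 ?powR_ge0 // ltW.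
  have [s Ss] := g_nonempty; have := f0 _ Ss.
  rewrite {1}(_ : f = mpolyC n (mcoeff mnm0 f)); first by rewrite /peval mevalC => /ltW.
  by apply: msize1_polyC; move: fd; rewrite /pdeg; case: (mmeasure _ f) => [|[]].
set d := d'.+1 in fd *.
have [[y0 Sy0 minE] hmin] := min_onP f g_nonempty g_compact.
set e := min_on f S in minE hmin.
have e0 : 0 < e by rewrite minE; exact: f0.
have hN x : cube x -> `|peval f x| <= sup_norm f := @sup_norm_ge R n f x.
set N := sup_norm f in hN.
have eN : e <= N.
  by rewrite minE; apply: le_trans (ler_norm _) _; exact/hN/g_cube.
have N0 : 0 < N := lt_le_trans e0 eN.
have kE : k = N / e by [].
have k1 : 1 <= k by rewrite kE ler_pdivlMr // mul1r.
have fd' : (pdeg f <= d)%N by rewrite fd.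
pose l := markov_const R n d * N.
have l0 : 0 < l.
  rewrite /l /markov_const !mulr_gt0 ?exprn_gt0 ?ltr0n //.
have hl x y : cube x -> cube y ->
    `|peval f x - peval f y| <= l * eucl_norm (x - y).
  exact: poly_lipschitz.
pose A := e / 2 * (2 * l / e) `^ (2 * L) * (c * M) ^+ 2.
have A0 : 0 <= A.
  by rewrite /A !mulr_ge0 ?powR_ge0 ?sqr_ge0 ?divr_ge0 // ltW.
have hF := lift_ge M0 g_nonempty g_cube L1 c_gt0 e0 l0 hc hmin hl.
pose W := d.+1%:R ^+ n * (2 ^+ n * N * 7 ^+ d) + A * V.
have hW : coef_bounded (d + E) W (lift g M A f) := hV _ _ _ _ fd' hN A0.
pose z := W * (d + E)%:R ^+ 2 / (e / 2).
have e20 : 0 < e / 2 by rewrite divr_gt0.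
have z0 : 0 <= z by rewrite !mulr_ge0 ?(coef_bounded_ge0 hW) // invr_ge0 ltW.
(* The Bernstein expansion needs [d + E <= r] besides [z <= r]. *)
pose r := (d + E + (Num.truncn z).+1)%N.
have zr : W * (d + E)%:R ^+ 2 <= e / 2 * r%:R.
  rewrite [leRHS]mulrC -ler_pdivrMr //.
  apply: (@le_trans _ _ (Num.truncn z).+1%:R).
    by have /andP[_ /ltW] := truncn_itv z0.
  by rewrite ler_nat leq_addl.
have [||b b0 Fb] := bernstein_nonneg (r := r) hW _ _ hF zr.
- by rewrite /r addnS.
- exact: leq_addr.
have rC : r%:R <= C * 60 ^+ d * k `^ (2 * L).
  apply: le_trans (hC d k k1).
  rewrite /r addnS -addSn natrD addrC lerD2r.
  apply: (@le_trans _ _ z); first by have /andP[] := truncn_itv z0.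
  rewrite /z mulrAC ler_wpM2r ?sqr_ge0 //.
  rewrite /W mulrDl; apply: lerD.
    rewrite le_eqVlt; apply/orP; left; apply/eqP.
    by rewrite kE; field; rewrite gt_eqF.
  have -> : 2 * (markov_const R n d * k) = 2 * l / e.
    by rewrite kE /l; field; rewrite gt_eqF.
  rewrite le_eqVlt; apply/orP; left; apply/eqP.
  rewrite /A; set B := _ `^ _.
  by field; rewrite gt_eqF.
rewrite -(comp_graph_lift g M A f) Fb raddf_sum /=.
have hgraph := preprime_graph M0 (ltn0Sn _) (fun j => leqW (pdeg_le_max_deg g j)) gM.
apply: preprime_le (_ : (n + m)%:R * (r%:R * D%:R) <= _) _.
  rewrite [leRHS]mulrC ler_wpM2l //.
  apply: (@le_trans _ _ (C * 60 ^+ d * k `^ (2 * L) * D%:R)).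
    by rewrite ler_wpM2r.
  have p1 : 1 <= d%:R `^ (4 * L + 3).
    rewrite -[leLHS](powRr0 (d%:R : R)) ler_powR ?ler1n //.
    by rewrite addr_ge0 // mulr_ge0 // ltW.
  have n1 : 1 <= n%:R ^+ (2 * max_deg g * d) :> R by rewrite exprn_ege1 // ler1n.
  have mulE (a1 a2 a3 a4 a5 a6 : R) :
      a1 * a2 * a3 * a4 * a5 * a6 = a1 * a3 * a6 * a2 * (a4 * a5) by ring.
  rewrite [leRHS]mulE.
  by rewrite ler_peMr ?mulr_ege1 // !mulr_ge0 ?powR_ge0 ?exprn_ge0 // ltW.
apply: preprime_sum => [|I _]; first by rewrite !mulr_ge0.
rewrite comp_mpolyZ; apply: preprimeZ => //.
rewrite rmorph_prod /=.
have -> : (n + m)%:R * (r%:R * D%:R) = \sum_(i < n + m) r%:R * D%:R :> R.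
  by rewrite sumr_const card_ord mulr_natl.
apply: preprime_prod => i _.
rewrite rmorph_bern /= comp_pvar; have [h1 h2] := hgraph i.
by apply: preprime_bern => //; rewrite -ltnS.
Qed.
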